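(* Let $p$ be an odd prime and $a\in\mathbb C$. If $\mathcal C$ is a non-pointed modular tensor category such that $\mathcal C_{\mathrm{pt}}\subseteq\mathcal C_{\mathrm{ad}}$ and $\operatorname{FPdim}(\mathcal C_{\mathrm{pt}})=p^k$ for some $k\in\mathbb N$, then $\big|\{X\in\mathcal O(\mathcal C_g) : \dim(X)=a\}\big|$ is divisible by $p$ for all $g\in\mathcal G(\mathcal C)$ with $g\ne 1$, where $\mathcal C=\bigoplus_{g\in\mathcal G(\mathcal C)}\mathcal C_g$ is the universal grading.
   Context: All categories are over an algebraically closed field of characteristic zero (here with dimensions regarded as complex numbers). A modular tensor category is a braided fusion category with a spherical structure whose $S$-matrix is invertible. $\mathcal O(\mathcal C_g)$ is the set of isomorphism classes of simple objects of $\mathcal C_g$. $\mathcal G(\mathcal C)$ is the group of isomorphism classes of invertible objects, $\mathcal C_{\mathrm{pt}}$ the fusion subcategory generated by the invertible objects, and $\mathcal C_{\mathrm{ad}}$ the adjoint subcategory, generated by all $X\otimes X^*$ with $X$ simple. $\mathcal C$ is pointed if $\mathcal C_{\mathrm{pt}}=\mathcal C$. The universal grading is the canonical faithful grading with trivial component $\mathcal C_{\mathrm{ad}}$; for modular $\mathcal C$ its grading group is isomorphic to $\mathcal G(\mathcal C)$. $\operatorname{FPdim}$ is the Frobenius-Perron dimension and $\dim(X)$ is the dimension of $X$ with respect to the spherical structure. *)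

(* Defs.v *)
From HB Require Import structures.
From mathcomp Require Import all_boot all_order all_fingroup all_algebra.
From mathcomp Require Import boolp classical_sets reals complex.

Set Implicit Arguments.
Unset Strict Implicit.
Unset Printing Implicit Defensive.

Import GRing.Theory Num.Theory.

Local Open Scope classical_set_scope.
Local Open Scope ring_scope.

Declare Scope cat_scope.
Delimit Scope cat_scope with cat.
Local Open Scope cat_scope.

Record linear_category (k : fieldType) := LinearCategory {
  obj :> Type;
  hom : obj -> obj -> vectType k;
  id_hom : forall X, hom X X;
  comp_hom : forall X Y Z, hom Y Z -> hom X Y -> hom X Z;
  comp_linearl : forall X Y Z (f : hom X Y),
    linear (fun g : hom Y Z => comp_hom g f);
  comp_linearr : forall X Y Z (g : hom Y Z),
    linear (fun f : hom X Y => comp_hom g f);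
  compA : forall W X Y Z (h : hom Y Z) (g : hom X Y) (f : hom W X),
    comp_hom h (comp_hom g f) = comp_hom (comp_hom h g) f;
  comp1m : forall X Y (f : hom X Y), comp_hom (id_hom Y) f = f;
  compm1 : forall X Y (f : hom X Y), comp_hom f (id_hom X) = f }.

Arguments id_hom {k _} X.
Notation "g ∘ f" := (comp_hom g f) (at level 50, left associativity) : cat_scope.

Section Linear.
Variables (k : fieldType) (C : linear_category k).
Implicit Types X Y Z W S : C.

Definition is_iso X Y (f : hom X Y) : Prop :=
  exists g : hom Y X, g ∘ f = id_hom X /\ f ∘ g = id_hom Y.

Definition isomorphic X Y : Prop := exists f : hom X Y, is_iso f.

Definition mono X Y (f : hom X Y) : Prop :=
  forall W (u v : hom W X), f ∘ u = f ∘ v -> u = v.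

Definition epi X Y (f : hom X Y) : Prop :=
  forall W (u v : hom Y W), u ∘ f = v ∘ f -> u = v.

Definition is_zero X : Prop := id_hom X = 0.

Definition is_kernel X Y K (f : hom X Y) (m : hom K X) : Prop :=
  f ∘ m = 0 /\
  forall W (u : hom W X), f ∘ u = 0 -> exists! v : hom W K, m ∘ v = u.

Definition is_cokernel X Y Q (f : hom X Y) (q : hom Y Q) : Prop :=
  q ∘ f = 0 /\
  forall W (u : hom Y W), u ∘ f = 0 -> exists! v : hom Q W, v ∘ q = u.

(* For [n = 0] this says that [S] is a zero object. *)
Definition direct_sum n (X_ : 'I_n -> C) S : Prop :=
  exists (inj : forall i, hom (X_ i) S) (prj : forall i, hom S (X_ i)),
    [/\ forall i, prj i ∘ inj i = id_hom (X_ i),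
        forall i j, i != j -> prj j ∘ inj i = 0
      & \sum_i (inj i ∘ prj i) = id_hom S].

Definition abelian_category : Prop :=
  [/\ forall n (X_ : 'I_n -> C), exists S, direct_sum X_ S,
      forall X Y (f : hom X Y), exists K (m : hom K X), is_kernel f m,
      forall X Y (f : hom X Y), exists Q (q : hom Y Q), is_cokernel f q,
      forall X Y (m : hom X Y), mono m ->
        exists Z (f : hom Y Z), is_kernel f m
    & forall X Y (q : hom X Y), epi q ->
        exists Z (f : hom Z X), is_cokernel f q].

Definition simple_obj X : Prop :=
  ~ is_zero X /\
  forall Z (m : hom Z X), mono m -> is_zero Z \/ is_iso m.

Definition semisimple : Prop :=
  forall X, exists n (X_ : 'I_n -> C),
    (forall i, simple_obj (X_ i)) /\ direct_sum X_ X.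

End Linear.

Record monoidal_category (k : fieldType) := MonoidalCategory {
  mon_cat :> linear_category k;
  tens : mon_cat -> mon_cat -> mon_cat;
  tensm : forall X X' Y Y' : mon_cat,
    hom X X' -> hom Y Y' -> hom (tens X Y) (tens X' Y');
  tens_id : forall X Y : mon_cat, tensm (id_hom X) (id_hom Y) = id_hom (tens X Y);
  tens_comp : forall (X X' X'' Y Y' Y'' : mon_cat) (f' : hom X' X'')
      (f : hom X X') (g' : hom Y' Y'') (g : hom Y Y'),
    tensm (f' ∘ f) (g' ∘ g) = tensm f' g' ∘ tensm f g;
  tens_linearl : forall (X X' Y Y' : mon_cat) (g : hom Y Y'),
    linear (fun f : hom X X' => tensm f g);
  tens_linearr : forall (X X' Y Y' : mon_cat) (f : hom X X'),
    linear (fun g : hom Y Y' => tensm f g);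
  unit_obj : mon_cat;
  assoc : forall X Y Z : mon_cat,
    hom (tens (tens X Y) Z) (tens X (tens Y Z));
  associ : forall X Y Z : mon_cat,
    hom (tens X (tens Y Z)) (tens (tens X Y) Z);
  assocK : forall X Y Z : mon_cat, associ X Y Z ∘ assoc X Y Z = id_hom _;
  associK : forall X Y Z : mon_cat, assoc X Y Z ∘ associ X Y Z = id_hom _;
  assoc_natural : forall (X X' Y Y' Z Z' : mon_cat)
      (f : hom X X') (g : hom Y Y') (h : hom Z Z'),
    assoc X' Y' Z' ∘ tensm (tensm f g) h = tensm f (tensm g h) ∘ assoc X Y Z;
  lunit : forall X : mon_cat, hom (tens unit_obj X) X;
  luniti : forall X : mon_cat, hom X (tens unit_obj X);
  lunitK : forall X : mon_cat, luniti X ∘ lunit X = id_hom _;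
  lunitiK : forall X : mon_cat, lunit X ∘ luniti X = id_hom _;
  lunit_natural : forall (X Y : mon_cat) (f : hom X Y),
    lunit Y ∘ tensm (id_hom unit_obj) f = f ∘ lunit X;
  runit : forall X : mon_cat, hom (tens X unit_obj) X;
  runiti : forall X : mon_cat, hom X (tens X unit_obj);
  runitK : forall X : mon_cat, runiti X ∘ runit X = id_hom _;
  runitiK : forall X : mon_cat, runit X ∘ runiti X = id_hom _;
  runit_natural : forall (X Y : mon_cat) (f : hom X Y),
    runit Y ∘ tensm f (id_hom unit_obj) = f ∘ runit X;
  pentagon : forall W X Y Z : mon_cat,
    assoc W X (tens Y Z) ∘ assoc (tens W X) Y Z =
    tensm (id_hom W) (assoc X Y Z) ∘ assoc W (tens X Y) Z
      ∘ tensm (assoc W X Y) (id_hom Z);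
  triangle : forall X Y : mon_cat,
    tensm (id_hom X) (lunit Y) ∘ assoc X unit_obj Y = tensm (runit X) (id_hom Y) }.

Arguments unit_obj {k} _.
Notation "X ⊗ Y" := (tens X Y) (at level 40, left associativity) : cat_scope.
Notation "f ⊠ g" := (tensm f g) (at level 40, left associativity) : cat_scope.

Section Monoidal.
Variables (k : fieldType) (C : monoidal_category k).
Implicit Types X Y Z : C.

(* [Y] is a left dual of [X], with evaluation [e] and coevaluation [c]. *)
Definition is_duality X Y (e : hom (Y ⊗ X) (unit_obj C)) (c : hom (unit_obj C) (X ⊗ Y))
    : Prop :=
  runit X ∘ (id_hom X ⊠ e) ∘ assoc X Y X ∘ (c ⊠ id_hom X) = lunit X /\
  lunit Y ∘ (e ⊠ id_hom Y) ∘ associ Y X Y ∘ (id_hom Y ⊠ c) = runit Y.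

Definition invertible X : Prop :=
  exists Y, isomorphic (X ⊗ Y) (unit_obj C) /\ isomorphic (Y ⊗ X) (unit_obj C).

End Monoidal.

Section PicardGroup.
Variables (k : fieldType) (C : monoidal_category k).
Implicit Types X Y Z : C.

Record Pic := PicClass {
  Pic_set :> set C;
  Pic_setP : exists2 X, invertible X & Pic_set = [set Y | isomorphic X Y] }.

HB.instance Definition _ := gen_eqMixin Pic.
HB.instance Definition _ := gen_choiceMixin Pic.

Lemma isomorphic_refl X : isomorphic X X.
Proof. by exists (id_hom X), (id_hom X); rewrite comp1m. Qed.

Lemma isomorphic_sym X Y : isomorphic X Y -> isomorphic Y X.
Proof. by move=> [f [g [gf fg]]]; exists g, f. Qed.

Lemma isomorphic_trans Y X Z :
  isomorphic X Y -> isomorphic Y Z -> isomorphic X Z.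
Proof.
move=> [f [f' [f'f ff']]] [g [g' [g'g gg']]].
exists (g ∘ f), (f' ∘ g'); split.
  by rewrite -compA (compA g') g'g comp1m.
by rewrite -compA (compA f) ff' comp1m.
Qed.

Lemma isomorphic_tens X X' Y Y' :
  isomorphic X X' -> isomorphic Y Y' -> isomorphic (X ⊗ Y) (X' ⊗ Y').
Proof.
move=> [f [f' [f'f ff']]] [g [g' [g'g gg']]].
by exists (f ⊠ g), (f' ⊠ g'); rewrite -!tens_comp f'f ff' g'g gg' !tens_id.
Qed.

Lemma isomorphic_assoc X Y Z : isomorphic ((X ⊗ Y) ⊗ Z) (X ⊗ (Y ⊗ Z)).
Proof. by exists (assoc X Y Z), (associ X Y Z); rewrite assocK associK. Qed.

Lemma isomorphic_lunit X : isomorphic (unit_obj C ⊗ X) X.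
Proof. by exists (lunit X), (luniti X); rewrite lunitK lunitiK. Qed.

Lemma isomorphic_runit X : isomorphic (X ⊗ unit_obj C) X.
Proof. by exists (runit X), (runiti X); rewrite runitK runitiK. Qed.

Lemma invertible_unit : invertible (unit_obj C).
Proof. by exists (unit_obj C); split; apply: isomorphic_lunit. Qed.

Lemma isomorphic_cancel X X' Y Y' :
  isomorphic (X ⊗ X') (unit_obj C) -> isomorphic (Y ⊗ Y') (unit_obj C) ->
  isomorphic ((X ⊗ Y) ⊗ (Y' ⊗ X')) (unit_obj C).
Proof.
move=> XX' YY'; apply: isomorphic_trans (isomorphic_assoc _ _ _) _.
apply: isomorphic_trans XX'; apply: isomorphic_tens (isomorphic_refl _) _.
apply: isomorphic_trans (isomorphic_sym (isomorphic_assoc _ _ _)) _.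
apply: isomorphic_trans (isomorphic_lunit _).
exact: isomorphic_tens (isomorphic_refl _).
Qed.

Lemma invertible_tens X Y : invertible X -> invertible Y -> invertible (X ⊗ Y).
Proof.
move=> [X' [XX' X'X]] [Y' [YY' Y'Y]]; exists (Y' ⊗ X').
by split; apply: isomorphic_cancel.
Qed.

Definition Pic_repr (g : Pic) : C := s2val (cid2 (Pic_setP g)).

Lemma Pic_reprP (g : Pic) : invertible (Pic_repr g).
Proof. exact: s2valP (cid2 (Pic_setP g)). Qed.

Lemma Pic_setE (g : Pic) : Pic_set g = [set Y | isomorphic (Pic_repr g) Y].
Proof. exact: s2valP' (cid2 (Pic_setP g)). Qed.

Definition Pic_class X (hX : invertible X) : Pic :=
  PicClass (ex_intro2 _ _ X hX erefl).

Lemma Pic_class_repr X (hX : invertible X) :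
  isomorphic (Pic_repr (Pic_class hX)) X.
Proof.
have := isomorphic_refl X.
by rewrite -[isomorphic X X]/(Pic_set (Pic_class hX) X) Pic_setE.
Qed.

Lemma Pic_eq (g h : Pic) : isomorphic (Pic_repr g) (Pic_repr h) -> g = h.
Proof.
move=> gh; have E : Pic_set g = Pic_set h.
  rewrite !Pic_setE; apply/seteqP; split => Y /=; apply: isomorphic_trans => //.
  exact: isomorphic_sym.
case: g h E {gh} => [A hA] [B hB] /= E; case: _ / E in hB *.
by congr PicClass; apply: Prop_irrelevance.
Qed.

Definition Pic_inverse (g : Pic) : C := sval (cid (Pic_reprP g)).

Lemma Pic_inverseP (g : Pic) :
  isomorphic (Pic_repr g ⊗ Pic_inverse g) (unit_obj C) /\
  isomorphic (Pic_inverse g ⊗ Pic_repr g) (unit_obj C).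
Proof. exact: svalP (cid (Pic_reprP g)). Qed.

Lemma invertible_inverse (g : Pic) : invertible (Pic_inverse g).
Proof. by exists (Pic_repr g); have [] := Pic_inverseP g. Qed.

Definition Pic_one : Pic := Pic_class invertible_unit.
Definition Pic_mul (g h : Pic) : Pic :=
  Pic_class (invertible_tens (Pic_reprP g) (Pic_reprP h)).
Definition Pic_inv (g : Pic) : Pic := Pic_class (invertible_inverse g).

Lemma Pic_mul_repr g h :
  isomorphic (Pic_repr (Pic_mul g h)) (Pic_repr g ⊗ Pic_repr h).
Proof. exact: Pic_class_repr. Qed.

Lemma Pic_mulA : associative Pic_mul.
Proof.
move=> f g h; apply: Pic_eq.
apply: isomorphic_trans (Pic_mul_repr _ _) _.
apply: isomorphic_trans (isomorphic_sym (Pic_mul_repr _ _)).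
apply: isomorphic_trans
  (isomorphic_tens (isomorphic_refl _) (Pic_mul_repr g h)) _.
apply: isomorphic_trans (isomorphic_sym (isomorphic_assoc _ _ _)) _.
by apply: isomorphic_tens (isomorphic_refl _);
  exact: isomorphic_sym (Pic_mul_repr _ _).
Qed.

Lemma Pic_mul1 : left_id Pic_one Pic_mul.
Proof.
move=> g; apply: Pic_eq; apply: isomorphic_trans (Pic_mul_repr _ _) _.
apply: isomorphic_trans (isomorphic_lunit _).
exact: isomorphic_tens (Pic_class_repr _) (isomorphic_refl _).
Qed.

Lemma Pic_mulr1 : right_id Pic_one Pic_mul.
Proof.
move=> g; apply: Pic_eq; apply: isomorphic_trans (Pic_mul_repr _ _) _.
apply: isomorphic_trans (isomorphic_runit _).
exact: isomorphic_tens (isomorphic_refl _) (Pic_class_repr _).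
Qed.

Lemma Pic_mulV : left_inverse Pic_one Pic_inv Pic_mul.
Proof.
move=> g; apply: Pic_eq; apply: isomorphic_trans (Pic_mul_repr _ _) _.
apply: isomorphic_trans (isomorphic_sym (Pic_class_repr _)).
apply: isomorphic_trans (Pic_inverseP g).2.
exact: isomorphic_tens (Pic_class_repr _) (isomorphic_refl _).
Qed.

Lemma Pic_mulrV : right_inverse Pic_one Pic_inv Pic_mul.
Proof.
move=> g; apply: Pic_eq; apply: isomorphic_trans (Pic_mul_repr _ _) _.
apply: isomorphic_trans (isomorphic_sym (Pic_class_repr _)).
apply: isomorphic_trans (Pic_inverseP g).1.
exact: isomorphic_tens (isomorphic_refl _) (Pic_class_repr _).
Qed.

HB.instance Definition _ :=
  isGroup.Build Pic Pic_mulA Pic_mul1 Pic_mulr1 Pic_mulV Pic_mulrV.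

End PicardGroup.

(* The simple objects [irr i] represent each isomorphism class of simple
   objects exactly once, so ['I_(rank C)] is the set O(C).  Each object comes
   with a chosen left dual; right duals are only required to exist. *)
Record fusion_category (k : fieldType) := FusionCategory {
  fus_cat :> monoidal_category k;
  fus_abelian : abelian_category fus_cat;
  fus_semisimple : semisimple fus_cat;
  unit_simple : simple_obj (unit_obj fus_cat);
  rank : nat;
  irr : 'I_rank -> fus_cat;
  irr_simple : forall i, simple_obj (irr i);
  irr_inj : forall i j, isomorphic (irr i) (irr j) -> i = j;
  irr_surj : forall X : fus_cat, simple_obj X -> exists i, isomorphic X (irr i);
  dual : fus_cat -> fus_cat;
  ev : forall X : fus_cat, hom (dual X ⊗ X) (unit_obj fus_cat);
  coev : forall X : fus_cat, hom (unit_obj fus_cat) (X ⊗ dual X);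
  dualP : forall X : fus_cat, is_duality (ev X) (coev X);
  right_dual : forall X : fus_cat,
    exists (Y : fus_cat) (e : hom (X ⊗ Y) (unit_obj fus_cat))
           (c : hom (unit_obj fus_cat) (Y ⊗ X)), is_duality e c }.

Section Fusion.
Variables (k : fieldType) (C : fusion_category k).
Implicit Types X Y Z S : C.

(* The scalar [c] such that [f = c *: id_hom (unit_obj C)], for [k] algebraically
   closed. *)
Definition unit_scalar (f : hom (unit_obj C) (unit_obj C)) : k :=
  coord [tuple id_hom (unit_obj C)] ord0 f.

(* The morphism into the dual corresponding to a pairing. *)
Definition mate X Z (e : hom (Z ⊗ X) (unit_obj C)) : hom Z (dual X) :=
  lunit (dual X) ∘ (e ⊠ id_hom (dual X)) ∘ associ Z X (dual X)
    ∘ (id_hom Z ⊠ coev X) ∘ runiti Z.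

Definition dualm X Y (f : hom X Y) : hom (dual Y) (dual X) :=
  mate (ev Y ∘ (id_hom (dual Y) ⊠ f)).

(* The canonical isomorphisms making the duality functor monoidal. *)
Definition dual_tens X Y : hom (dual Y ⊗ dual X) (dual (X ⊗ Y)) :=
  mate (ev Y
    ∘ (id_hom (dual Y) ⊠ (lunit Y ∘ (ev X ⊠ id_hom Y) ∘ associ (dual X) X Y))
    ∘ assoc (dual Y) (dual X) (X ⊗ Y)).

Definition dual_unit : hom (unit_obj C) (dual (unit_obj C)) := mate (lunit (unit_obj C)).

Definition fusion_subcategory (D : set C) : Prop :=
  [/\ D (unit_obj C),
      forall X Y, D X -> D Y -> D (X ⊗ Y),
      forall X, D X -> D (dual X),
      forall n (X_ : 'I_n -> C) S,
        (forall i, D (X_ i)) -> direct_sum X_ S -> D S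
    & (forall X Y (m : hom X Y), mono m -> D Y -> D X) /\
      (forall X Y (q : hom X Y), epi q -> D X -> D Y)].

Definition fusion_generated (A : set C) : set C :=
  [set X | forall D : set C, fusion_subcategory D -> A `<=` D -> D X].

Definition pointed_part : set C :=
  fusion_generated [set X | invertible X].

Definition adjoint_part : set C :=
  fusion_generated [set Y | exists2 X, simple_obj X & Y = X ⊗ dual X].

Definition pointed : Prop := pointed_part = setT.

Definition grading (G : groupType) (C_ : G -> set C) : Prop :=
  [/\ forall g n (X_ : 'I_n -> C) S,
        (forall i, C_ g (X_ i)) -> direct_sum X_ S -> C_ g S,
      forall g h X Y (f : hom X Y), g != h -> C_ g X -> C_ h Y -> f = 0,
      forall X, exists n (X_ : 'I_n -> C) (d : 'I_n -> G),
        (forall i, C_ (d i) (X_ i)) /\ direct_sum X_ X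
    & forall g h X Y, C_ g X -> C_ h Y -> C_ (g * h)%g (X ⊗ Y)].

Definition faithful_grading (G : groupType) (C_ : G -> set C) : Prop :=
  grading C_ /\ forall g, exists2 X, C_ g X & ~ is_zero X.

(* The universal grading is determined by these properties up to an
   isomorphism of grading groups. *)
Definition universal_grading (G : groupType) (C_ : G -> set C) : Prop :=
  faithful_grading C_ /\ C_ 1%g = adjoint_part.

(* [irr l] has multiplicity [dim Hom (irr l) (irr i ⊗ irr j)] in
   [irr i ⊗ irr j]. *)
Definition fusion_matrix (R : realType) (i : 'I_(rank C)) : 'M[R]_(rank C) :=
  \matrix_(j, l) (\dim {: hom (irr l) (irr i ⊗ irr j)})%:R.

(* The largest nonnegative eigenvalue, which exists by Frobenius-Perron. *)
Definition FPdim (R : realType) (i : 'I_(rank C)) : R :=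
  sup [set x : R | 0 <= x /\ eigenvalue (fusion_matrix R i) x].

Definition FPdim_sub (R : realType) (D : set C) : R :=
  \sum_(i < rank C | `[< D (irr i) >]) FPdim R i ^+ 2.

Record braiding := Braiding {
  braid :> forall X Y, hom (X ⊗ Y) (Y ⊗ X);
  braid_iso : forall X Y, is_iso (braid X Y);
  braid_natural : forall X X' Y Y' (f : hom X X') (g : hom Y Y'),
    braid X' Y' ∘ (f ⊠ g) = (g ⊠ f) ∘ braid X Y;
  hexagonl : forall X Y Z,
    assoc Y Z X ∘ braid X (Y ⊗ Z) ∘ assoc X Y Z =
    (id_hom Y ⊠ braid X Z) ∘ assoc Y X Z ∘ (braid X Y ⊠ id_hom Z);
  hexagonr : forall X Y Z,
    associ Z X Y ∘ braid (X ⊗ Y) Z ∘ associ X Y Z =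
    (braid X Z ⊠ id_hom Y) ∘ associ X Z Y ∘ (id_hom X ⊠ braid Y Z) }.

(* A monoidal natural isomorphism from the identity to the double dual. *)
Record pivotal_structure := PivotalStructure {
  piv :> forall X, hom X (dual (dual X));
  piv_iso : forall X, is_iso (piv X);
  piv_natural : forall X Y (f : hom X Y),
    piv Y ∘ f = dualm (dualm f) ∘ piv X;
  piv_tens : forall X Y,
    dualm (dual_tens X Y) ∘ piv (X ⊗ Y) =
    dual_tens (dual Y) (dual X) ∘ (piv X ⊠ piv Y);
  piv_unit : dualm dual_unit ∘ piv (unit_obj C) = dual_unit }.

Definition ptrace (a : pivotal_structure) X (f : hom X X) : k :=
  unit_scalar (ev (dual X) ∘ ((a X ∘ f) ⊠ id_hom (dual X)) ∘ coev X).

Definition pdim (a : pivotal_structure) X : k := ptrace a (id_hom X).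

Definition spherical (a : pivotal_structure) : Prop :=
  forall X, pdim a X = pdim a (dual X).

Definition S_matrix (c : braiding) (a : pivotal_structure) : 'M[k]_(rank C) :=
  \matrix_(i, j) ptrace a (c (irr j) (irr i) ∘ c (irr i) (irr j)).

End Fusion.

Arguments pointed_part {k} C _.
Arguments adjoint_part {k} C _.

Record modular_category (k : fieldType) := ModularCategory {
  mod_cat :> fusion_category k;
  mod_braiding : braiding mod_cat;
  mod_pivotal : pivotal_structure mod_cat;
  mod_spherical : spherical mod_pivotal;
  S_matrix_unit : S_matrix mod_braiding mod_pivotal \in unitmx }.

Definition qdim (k : fieldType) (C : modular_category k) (X : C) : k :=
  pdim (mod_pivotal C) X.

(* [iota] is a field embedding on the elements of [k] algebraic over the
   rationals, such as dimensions; its other values are irrelevant.  A field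
   [k] of large cardinality has no embedding into the complex numbers. *)
Definition algebraic_embedding (k : fieldType) (R : realType)
    (iota : k -> R[i]) : Prop :=
  let alg := fun x : k => algebraicOver (ratr : rat -> k) x in
  [/\ iota 1 = 1,
      forall x y, alg x -> alg y -> iota (x + y) = iota x + iota y
    & forall x y, alg x -> alg y -> iota (x * y) = iota x * iota y].

(* Main.v *)
Require Import Defs.
From HB Require Import structures.
From mathcomp Require Import all_boot all_order all_fingroup all_solvable all_algebra.
From mathcomp Require Import boolp classical_sets reals complex.

(** Let [G] be the group of invertible objects.  Its order is a power of [p],
    because the dimension of the pointed part counts invertible objects
    ([FPdim_pointed]).  Tensoring with invertible objects is an action of [G] on
    the simple objects.  It preserves the component of degree [g], since the
    pointed part has trivial degree, and it preserves dimensions: the dimension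
    of an invertible object squares to 1, since an object and its dual have the
    same dimension, and it is a root of unity of odd order ([qdim_Pic_repr]).  So
    it is enough to see that no simple object [X] of degree [g <> 1] is fixed by
    the whole of [G].

    For [h] invertible the double braiding of [h] with [X] is a scalar [b h X].
    It is multiplicative in [h], it is trivial for [X] in the adjoint part
    ([dbraid_adjoint]), and so it only depends on the degree of [X]: we get a
    pairing [b] of [G] with the grading group ([monodromy]).  If [b h] is trivial
    then the rows of the S-matrix at [h] and at the unit are proportional, so
    that [h = 1] ([transparent_Pic_eq1]).  As the grading group is indexed by [G]
    itself, both sides have the same finite order, and summing all the values of
    [b] in two ways shows that its kernel on the side of degrees is trivial as
    well ([bichar_nondegenerate]).

    Now assume that [h ⊗ X ≅ X].  The maps from [h] to [X ⊗ dual X] form a line,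
    on which the double braiding of [X] with [dual X] acts by a scalar.  A
    generator can be produced from the coevaluation by absorbing [h] either in
    [X] or in [dual X]; comparing the two gives [b h (dual X) = b h X]
    ([dbraid_scalar_fixed]).  But [b h (dual X)] is also the inverse of [b h X],
    whence [b h X] squares to 1, and it is 1 since [G] has odd order.  If [X] is
    fixed by all [h], its degree is therefore in the kernel of [b], so it is 1
    ([fixed_degree1]).

    The traces only enter through two properties of the pivotal dimension:
    invariance under isomorphism and multiplicativity ([pdim_iso],
    [pdim_tens]).  To prove the latter without strictifying the category, an
    evaluation or coevaluation is replaced by the natural transformation which it
    induces between functors of tensoring on the left ([pair_act],
    [copair_act]). *)

Set Implicit Arguments.
Unset Strict Implicit.
Unset Printing Implicit Defensive.

Import Defs GRing.Theory Num.Theory VectorInternalTheory.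
Local Open Scope classical_set_scope.
Local Open Scope ring_scope.
Local Open Scope cat_scope.

(** * Semisimple linear categories and Schur's lemma *)

Section LinearCategory.
Variables (k : fieldType) (C : linear_category k).
Implicit Types V W X Y Z S : C.

Definition precomp X Y Z (f : hom X Y) (g : hom Y Z) : hom X Z := g ∘ f.
Definition postcomp X Y Z (g : hom Y Z) (f : hom X Y) : hom X Z := g ∘ f.

HB.instance Definition _ X Y Z (f : hom X Y) :=
  GRing.isLinear.Build k (hom Y Z) (hom X Z) *:%R (precomp f) (comp_linearl f).
HB.instance Definition _ X Y Z (g : hom Y Z) :=
  GRing.isLinear.Build k (hom X Y) (hom X Z) *:%R (postcomp g) (comp_linearr g).

Lemma comp0m X Y Z (f : hom X Y) : (0 : hom Y Z) ∘ f = 0.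
Proof. exact: linear0 (precomp f). Qed.
Lemma compm0 X Y Z (g : hom Y Z) : g ∘ (0 : hom X Y) = 0.
Proof. exact: linear0 (postcomp g). Qed.
Lemma compBm X Y Z (f : hom X Y) (g h : hom Y Z) : (g - h) ∘ f = (g ∘ f) - (h ∘ f).
Proof. exact: linearB (precomp f) _ _. Qed.
Lemma compmB X Y Z (g : hom Y Z) (f h : hom X Y) : g ∘ (f - h) = (g ∘ f) - (g ∘ h).
Proof. exact: linearB (postcomp g) _ _. Qed.
Lemma compZm X Y Z (f : hom X Y) a (g : hom Y Z) : (a *: g) ∘ f = a *: (g ∘ f).
Proof. exact: (linearZ_LR (precomp f)). Qed.
Lemma compmZ X Y Z (g : hom Y Z) a (f : hom X Y) : g ∘ (a *: f) = a *: (g ∘ f).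
Proof. exact: (linearZ_LR (postcomp g)). Qed.
Lemma comp_sumr X Y Z (g : hom Y Z) I (r : seq I) (F : I -> hom X Y) :
  g ∘ (\sum_(i <- r) F i) = \sum_(i <- r) (g ∘ F i).
Proof. exact: (raddf_sum (postcomp g)). Qed.
Lemma comp_suml X Y Z (f : hom X Y) I (r : seq I) (F : I -> hom Y Z) :
  (\sum_(i <- r) F i) ∘ f = \sum_(i <- r) (F i ∘ f).
Proof. exact: (raddf_sum (precomp f)). Qed.

(** These two rewrite a composite in the middle of a left-associated one. *)
Lemma compr W X Y Z (a : hom X Y) (b : hom W X) (c : hom W Y) :
  a ∘ b = c -> forall x : hom Y Z, x ∘ a ∘ b = x ∘ c.
Proof. by move=> E x; rewrite -compA E. Qed.

Lemma compr3 V W X Y Z (a : hom X Y) (b : hom W X) (c : hom V W) (d : hom V Y) :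
  a ∘ b ∘ c = d -> forall x : hom Y Z, x ∘ a ∘ b ∘ c = x ∘ d.
Proof. by move=> E x; rewrite -E !compA. Qed.

Lemma iso_nz X Y Z (f : hom X Y) (g : hom Y Z) : is_iso g -> f != 0 -> g ∘ f != 0.
Proof.
move=> [g' [g'g _]]; apply: contra_neq => gf0.
by rewrite -[f]comp1m -g'g -compA gf0 compm0.
Qed.

Lemma nz_iso X Y Z (f : hom X Y) (g : hom Y Z) : is_iso f -> g != 0 -> g ∘ f != 0.
Proof.
move=> [f' [_ ff']]; apply: contra_neq => gf0.
by rewrite -[g]compm1 -ff' compA gf0 comp0m.
Qed.

Lemma iso_comp X Y Z (f : hom X Y) (g : hom Y Z) :
  is_iso f -> is_iso g -> is_iso (g ∘ f).
Proof.
move=> [f' [f'f ff']] [g' [g'g gg']]; exists (f' ∘ g').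
by rewrite !compA !(compr g'g, compr ff') !compm1.
Qed.

Lemma iso_mono X Y (f : hom X Y) : is_iso f -> mono f.
Proof.
by move=> [f' [f'f _]] W u v E; rewrite -[u]comp1m -[v]comp1m -f'f -!compA E.
Qed.

Lemma isomorphic_is_zero X Y : isomorphic X Y -> is_zero Y -> is_zero X.
Proof.
by move=> [f [f' [f'f _]]] Y0; rewrite /is_zero -f'f -[f]comp1m Y0 comp0m compm0.
Qed.

Lemma sum_comp_nz n (X_ : 'I_n -> C) X Y (inj : forall i, hom (X_ i) X)
    (prj : forall i, hom X (X_ i)) (f : hom X Y) :
  \sum_i (inj i ∘ prj i) = id_hom X -> f != 0 -> exists i, f ∘ inj i != 0.
Proof.
move=> sum1 fnz; apply: contrapT => /forallNP f0; case/eqP: fnz.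
rewrite -[f]compm1 -sum1 comp_sumr big1 // => i _.
by rewrite compA; have /negP/negPn/eqP -> := f0 i; rewrite comp0m.
Qed.

Lemma comp_sum_nz n (X_ : 'I_n -> C) X Y (inj : forall i, hom (X_ i) X)
    (prj : forall i, hom X (X_ i)) (f : hom Y X) :
  \sum_i (inj i ∘ prj i) = id_hom X -> f != 0 -> exists i, prj i ∘ f != 0.
Proof.
move=> sum1 fnz; apply: contrapT => /forallNP f0; case/eqP: fnz.
rewrite -[f]comp1m -sum1 comp_suml big1 // => i _.
by rewrite -compA; have /negP/negPn/eqP -> := f0 i; rewrite compm0.
Qed.

Lemma simple_id_nz S : simple_obj S -> id_hom S != 0.
Proof. by case=> /eqP. Qed.

Lemma isomorphic_simple X Y : isomorphic X Y -> simple_obj X -> simple_obj Y.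
Proof.
move=> XY [Xnz Xs]; split; first by move=> /(isomorphic_is_zero XY).
case: XY => f [f' [f'f ff']] Z m mm.
have [|Z0|m'i] := Xs Z (f' ∘ m); [|by left|right].
  move=> W u v; rewrite -!compA => E; apply: mm.
  by rewrite -[m ∘ u]comp1m -[m ∘ v]comp1m -ff' -!compA E.
have -> : m = f ∘ (f' ∘ m) by rewrite compA ff' comp1m.
by apply: iso_comp m'i _; exists f'.
Qed.

Hypothesis C_abelian : abelian_category C.

(** A nonzero map from a simple object has zero kernel, hence is a monomorphism
    into a simple object. *)
Lemma schur_iso S T (f : hom S T) :
  simple_obj S -> simple_obj T -> f != 0 -> is_iso f.
Proof.
have [_ kers _ _ _] := C_abelian.
move=> [_ Ss] [_ Ts] fnz; have [K [m [fm0 mU]]] := kers _ _ f.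
have mm : mono m.
  move=> W u v E; have [|w [_ wU]] := mU W (m ∘ u); first by rewrite compA fm0 comp0m.
  by rewrite -(wU u erefl) (wU v (esym E)).
have [K0|mi] := Ss K m mm; last by have := nz_iso mi fnz; rewrite fm0 eqxx.
have /Ts[S0|//] : mono f; last by case/eqP: fnz; rewrite -[f]compm1 S0 compm0.
move=> W u v E; have [|w [mw _]] := mU W (u - v); first by rewrite compmB E subrr.
by apply/eqP; rewrite -subr_eq0 -mw -[w]comp1m K0 comp0m compm0.
Qed.

Lemma schur_isomorphic S T (f : hom S T) :
  simple_obj S -> simple_obj T -> f != 0 -> isomorphic S T.
Proof. by move=> Ss Ts fnz; exists f; apply: schur_iso. Qed.

Hypothesis C_semisimple : semisimple C.

(** One of the components of [f] in a decomposition of [Y] is an isomorphism, by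
    Schur's lemma. *)
Lemma simple_retraction S Y (f : hom S Y) :
  simple_obj S -> f != 0 -> exists r : hom Y S, r ∘ f = id_hom S.
Proof.
move=> Ss fnz; have [n [Y_ [Ys [inj [prj [_ _ sum1]]]]]] := C_semisimple Y.
have [i pfnz] := comp_sum_nz sum1 fnz.
have [g [gpf _]] := schur_iso Ss (Ys i) pfnz.
by exists (g ∘ prj i); rewrite -compA.
Qed.

Lemma simple_section S Y (f : hom Y S) :
  simple_obj S -> f != 0 -> exists s : hom S Y, f ∘ s = id_hom S.
Proof.
move=> Ss fnz; have [n [Y_ [Ys [inj [prj [_ _ sum1]]]]]] := C_semisimple Y.
have [i finz] := sum_comp_nz sum1 fnz.
have [g [_ fig]] := schur_iso (Ys i) Ss finz.
by exists (inj i ∘ g); rewrite compA.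
Qed.

Lemma simple_constituent Y : ~ is_zero Y ->
  exists2 S, simple_obj S & exists f : hom S Y, f != 0.
Proof.
move=> Ynz; have [n [Y_ [Ys [inj [prj [pi _ sum1]]]]]] := C_semisimple Y.
case: n => [|n] in Y_ Ys inj prj pi sum1 *; first by rewrite big_ord0 in sum1; case: Ynz.
exists (Y_ ord0) => //; exists (inj ord0).
by apply: contra_neq (simple_id_nz (Ys ord0)) => i0; rewrite -pi i0 compm0.
Qed.

(** An object with only scalar endomorphisms has no proper summand. *)
Lemma scalar_end_simple Y : ~ is_zero Y ->
  (forall f : hom Y Y, exists a, f = a *: id_hom Y) -> simple_obj Y.
Proof.
move=> Ynz Ysc; have [S Ss [f fnz]] := simple_constituent Ynz.
have [r rf] := simple_retraction Ss fnz; have [a fr] := Ysc (f ∘ r).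
apply: isomorphic_simple Ss.
have anz : a != 0.
  by apply: contra_neq fnz => a0; rewrite -[f]compm1 -rf compA fr a0 scale0r comp0m.
exists f, (a^-1 *: r); split; last by rewrite compmZ fr scalerA mulVf // scale1r.
have := congr1 (fun u => r ∘ u ∘ f) fr.
rewrite compmZ compZm compm1 rf !compA rf comp1m rf => a1.
by rewrite compZm rf {1}a1 scalerA mulVf // scale1r.
Qed.

End LinearCategory.

Section SchurScalar.
Variables (k : closedFieldType) (C : linear_category k).
Hypothesis C_abelian : abelian_category C.
Implicit Types S T : C.

(** Over an algebraically closed field, composition with [f] has an eigenvalue
    on the finite-dimensional algebra of endomorphisms of [S], and [f] minus
    this eigenvalue is then not invertible. *)
Lemma schur_scalar S (f : hom S S) : simple_obj S -> exists a, f = a *: id_hom S.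
Proof.
move=> Ss; pose M := lin1_mx (v2r \o @postcomp _ _ S _ _ f \o r2v).
have nz : (0 < dim (hom S S))%N.
  rewrite lt0n; apply: contraNneq (simple_id_nz Ss) => d0.
  apply/eqP/(can_inj v2rK); move: (v2r _) (v2r _).
  by rewrite d0 => u v; rewrite [u]thinmx0 [v]thinmx0.
have [a /eigenvalueP[v vM vnz]] : exists a, eigenvalue M a.
  have [|a aM] := closed_rootP (char_poly M) _; last by exists a; rewrite eigenvalue_root_char.
  by rewrite size_char_poly eqSS -lt0n.
exists a; apply/eqP; rewrite -subr_eq0; apply: contraT => fnz.
have := iso_nz (schur_iso C_abelian Ss Ss fnz) (f := r2v v).
suff -> : (f - a *: id_hom S) ∘ r2v v = 0.
  by rewrite eqxx -(can_eq v2rK) linear0 r2vK => /(_ vnz).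
apply/eqP; rewrite compBm compZm comp1m subr_eq0 -(can_eq v2rK) linearZ /= r2vK -vM.
by rewrite mul_rV_lin1.
Qed.

Lemma schur_line S T (f g : hom S T) :
  simple_obj S -> simple_obj T -> f != 0 -> exists a, g = a *: f.
Proof.
move=> Ss Ts /(schur_iso C_abelian Ss Ts)[f' [f'f ff']].
have [a ga] := schur_scalar (f' ∘ g) Ss; exists a.
by rewrite -[g]comp1m -ff' -compA ga compmZ compm1.
Qed.

End SchurScalar.

(** * Dualities as natural transformations *)

Section MonoidalCategory.
Variables (k : fieldType) (C : monoidal_category k).
Implicit Types W X Y Z A B : C.
Local Notation "𝟙" := (unit_obj C).

Definition tensl X X' Y Y' (g : hom Y Y') (f : hom X X') : hom (X ⊗ Y) (X' ⊗ Y') :=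
  f ⊠ g.
Definition tensr X X' Y Y' (f : hom X X') (g : hom Y Y') : hom (X ⊗ Y) (X' ⊗ Y') :=
  f ⊠ g.

HB.instance Definition _ X X' Y Y' (g : hom Y Y') :=
  GRing.isLinear.Build k (hom X X') (hom (X ⊗ Y) (X' ⊗ Y')) *:%R (tensl g)
    (tens_linearl g).
HB.instance Definition _ X X' Y Y' (f : hom X X') :=
  GRing.isLinear.Build k (hom Y Y') (hom (X ⊗ Y) (X' ⊗ Y')) *:%R (tensr f)
    (tens_linearr f).

Lemma tens0m X X' Y Y' (g : hom Y Y') : (0 : hom X X') ⊠ g = 0.
Proof. exact: linear0 (tensl g). Qed.
Lemma tensm0 X X' Y Y' (f : hom X X') : f ⊠ (0 : hom Y Y') = 0.
Proof. exact: linear0 (tensr f). Qed.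
Lemma tensZm X X' Y Y' a (f : hom X X') (g : hom Y Y') : (a *: f) ⊠ g = a *: (f ⊠ g).
Proof. exact: (linearZ_LR (tensl g)). Qed.
Lemma tensmZ X X' Y Y' a (f : hom X X') (g : hom Y Y') : f ⊠ (a *: g) = a *: (f ⊠ g).
Proof. exact: (linearZ_LR (tensr f)). Qed.
Lemma tens_suml X X' Y Y' (g : hom Y Y') I (r : seq I) (F : I -> hom X X') :
  (\sum_(i <- r) F i) ⊠ g = \sum_(i <- r) (F i ⊠ g).
Proof. exact: (raddf_sum (tensl g)). Qed.
Lemma tens_sumr X X' Y Y' (f : hom X X') I (r : seq I) (F : I -> hom Y Y') :
  f ⊠ (\sum_(i <- r) F i) = \sum_(i <- r) (f ⊠ F i).
Proof. exact: (raddf_sum (tensr f)). Qed.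

Lemma whiskl X Y Y' Y'' (g : hom Y' Y'') (f : hom Y Y') :
  id_hom X ⊠ (g ∘ f) = (id_hom X ⊠ g) ∘ (id_hom X ⊠ f).
Proof. by rewrite -tens_comp comp1m. Qed.
Lemma whiskr X Y Y' Y'' (g : hom Y' Y'') (f : hom Y Y') :
  (g ∘ f) ⊠ id_hom X = (g ⊠ id_hom X) ∘ (f ⊠ id_hom X).
Proof. by rewrite -tens_comp comp1m. Qed.
Lemma tens_lr X X' Y Y' (f : hom X X') (g : hom Y Y') :
  (f ⊠ id_hom Y') ∘ (id_hom X ⊠ g) = f ⊠ g.
Proof. by rewrite -tens_comp comp1m compm1. Qed.
Lemma tens_rl X X' Y Y' (f : hom X X') (g : hom Y Y') :
  (id_hom X' ⊠ g) ∘ (f ⊠ id_hom Y) = f ⊠ g.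
Proof. by rewrite -tens_comp comp1m compm1. Qed.

Lemma is_iso_id X : is_iso (id_hom X).
Proof. by exists (id_hom X); rewrite comp1m. Qed.

Lemma is_iso_tens X X' Y Y' (f : hom X X') (g : hom Y Y') :
  is_iso f -> is_iso g -> is_iso (f ⊠ g).
Proof.
move=> [f' [f'f ff']] [g' [g'g gg']]; exists (f' ⊠ g').
by rewrite -!tens_comp f'f ff' g'g gg' !tens_id.
Qed.

Lemma is_iso_assoc X Y Z : is_iso (assoc X Y Z).
Proof. by exists (associ X Y Z); rewrite assocK associK. Qed.
Lemma is_iso_associ X Y Z : is_iso (associ X Y Z).
Proof. by exists (assoc X Y Z); rewrite assocK associK. Qed.
Lemma is_iso_lunit X : is_iso (lunit X).
Proof. by exists (luniti X); rewrite lunitK lunitiK. Qed.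
Lemma is_iso_runit X : is_iso (runit X).
Proof. by exists (runiti X); rewrite runitK runitiK. Qed.
Lemma is_iso_runiti X : is_iso (runiti X).
Proof. by exists (runit X); rewrite runitK runitiK. Qed.

Lemma associ_natural X X' Y Y' Z Z' (f : hom X X') (g : hom Y Y') (h : hom Z Z') :
  associ X' Y' Z' ∘ (f ⊠ (g ⊠ h)) = ((f ⊠ g) ⊠ h) ∘ associ X Y Z.
Proof.
rewrite -[LHS]compm1 -(associK X Y Z) compA (compr (esym (assoc_natural f g h))).
by rewrite compA assocK comp1m.
Qed.

Lemma luniti_natural X Y (f : hom X Y) :
  luniti Y ∘ f = (id_hom 𝟙 ⊠ f) ∘ luniti X.
Proof.
rewrite -[LHS]compm1 -(lunitiK X) compA (compr (esym (lunit_natural f))).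
by rewrite compA lunitK comp1m.
Qed.

Lemma unit_whiskl_inj X Y (f g : hom X Y) : id_hom 𝟙 ⊠ f = id_hom 𝟙 ⊠ g -> f = g.
Proof.
move=> E; rewrite -[f]compm1 -[g]compm1 -(lunitiK X) ?compA.
by rewrite -!lunit_natural E.
Qed.

Lemma unit_whiskr_inj X Y (f g : hom X Y) : f ⊠ id_hom 𝟙 = g ⊠ id_hom 𝟙 -> f = g.
Proof.
move=> E; rewrite -[f]compm1 -[g]compm1 -(runitiK X) ?compA.
by rewrite -!runit_natural E.
Qed.

Lemma compr_inj X Y Z (h : hom X Y) (f g : hom Y Z) : is_iso h -> f ∘ h = g ∘ h -> f = g.
Proof. by move=> [h' [_ hh']] E; rewrite -[f]compm1 -[g]compm1 -hh' ?compA E. Qed.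

(** Kelly's argument: the identity may be checked after tensoring with the unit on
    the left, where it follows from the pentagon and the triangle axiom. *)
Lemma lunit_tens X Y : lunit (X ⊗ Y) ∘ assoc 𝟙 X Y = lunit X ⊠ id_hom Y.
Proof.
apply: unit_whiskl_inj.
have i : is_iso (assoc 𝟙 (𝟙 ⊗ X) Y ∘ (assoc 𝟙 𝟙 X ⊠ id_hom Y)).
  by apply: iso_comp (is_iso_assoc _ _ _); apply: is_iso_tens (is_iso_id _);
     exact: is_iso_assoc.
apply: (compr_inj i); rewrite whiskl ?compA (compr3 (esym (pentagon _ _ _ _))).
rewrite compA triangle -tens_id (esym (assoc_natural _ _ _)) -triangle whiskr.
by rewrite compA assoc_natural.
Qed.

Lemma pentagoni W X Y Z :
  associ (W ⊗ X) Y Z ∘ associ W X (Y ⊗ Z) =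
  (associ W X Y ⊠ id_hom Z) ∘ associ W (X ⊗ Y) Z ∘ (id_hom W ⊠ associ X Y Z).
Proof.
have i : is_iso (assoc W X (Y ⊗ Z) ∘ assoc (W ⊗ X) Y Z).
  exact: iso_comp (is_iso_assoc _ _ _) (is_iso_assoc _ _ _).
apply: (compr_inj i); rewrite [in RHS]pentagon ?compA.
rewrite (compr (assocK _ _ _)) compm1 assocK.
rewrite (compr (esym (whiskl _ _ _))) assocK tens_id compm1.
by rewrite (compr (assocK _ _ _)) compm1 -whiskr assocK tens_id.
Qed.

Lemma lunit_tensE X Y : lunit (X ⊗ Y) = (lunit X ⊠ id_hom Y) ∘ associ 𝟙 X Y.
Proof. by rewrite -lunit_tens -compA associK compm1. Qed.

(** The pairing [e] and the copairing [c] as natural transformations between the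
    functors of tensoring on the left.  Composition of functors being strictly
    associative, no associativity constraint appears in the triangle identities
    below.  The bodies are locked so that rewriting does not unfold them. *)
Definition pair_act Z X (e : hom (Z ⊗ X) 𝟙) A : hom (Z ⊗ (X ⊗ A)) A :=
  locked (lunit A ∘ (e ⊠ id_hom A) ∘ associ Z X A).
Definition copair_act X Y (c : hom 𝟙 (X ⊗ Y)) A : hom A (X ⊗ (Y ⊗ A)) :=
  locked (assoc X Y A ∘ (c ⊠ id_hom A) ∘ luniti A).

Lemma pair_actE Z X (e : hom (Z ⊗ X) 𝟙) A :
  pair_act e A = lunit A ∘ (e ⊠ id_hom A) ∘ associ Z X A.
Proof. by rewrite /pair_act -lock. Qed.
Lemma copair_actE X Y (c : hom 𝟙 (X ⊗ Y)) A :
  copair_act c A = assoc X Y A ∘ (c ⊠ id_hom A) ∘ luniti A.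
Proof. by rewrite /copair_act -lock. Qed.

Lemma pair_act_natural Z X (e : hom (Z ⊗ X) 𝟙) A B (f : hom A B) :
  pair_act e B ∘ (id_hom Z ⊠ (id_hom X ⊠ f)) = f ∘ pair_act e A.
Proof.
rewrite !pair_actE (compr (associ_natural _ _ _)) tens_id ?compA.
by rewrite (compr (tens_lr _ _)) -tens_rl ?compA lunit_natural.
Qed.

Lemma copair_act_natural X Y (c : hom 𝟙 (X ⊗ Y)) A B (f : hom A B) :
  (id_hom X ⊠ (id_hom Y ⊠ f)) ∘ copair_act c A = copair_act c B ∘ f.
Proof.
rewrite !copair_actE ?compA -assoc_natural tens_id (compr (tens_rl _ _)).
by rewrite (compr (luniti_natural _)) ?compA (compr (tens_lr _ _)).
Qed.

Lemma pair_act_comp Z Z' X X' (e : hom (Z' ⊗ X') 𝟙) (f : hom Z Z') (g : hom X X') A :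
  pair_act (e ∘ (f ⊠ g)) A = pair_act e A ∘ (f ⊠ (g ⊠ id_hom A)).
Proof. by rewrite !pair_actE whiskr ?compA (compr (associ_natural _ _ _)) ?compA. Qed.

Lemma copair_act_comp X X' Y Y' (c : hom 𝟙 (X ⊗ Y)) (f : hom X X') (g : hom Y Y') A :
  copair_act ((f ⊠ g) ∘ c) A = (f ⊠ (g ⊠ id_hom A)) ∘ copair_act c A.
Proof. by rewrite !copair_actE whiskr ?compA -assoc_natural. Qed.

Lemma pair_act_inj Z X (e e' : hom (Z ⊗ X) 𝟙) :
  (forall A, pair_act e A = pair_act e' A) -> e = e'.
Proof.
move=> /(_ 𝟙) E; apply: unit_whiskr_inj.
apply: (compr_inj (is_iso_associ Z X 𝟙)); apply: (iso_mono (is_iso_lunit _)).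
by move: E; rewrite !pair_actE ?compA.
Qed.

Lemma pair_copair X Y (e : hom (X ⊗ Y) 𝟙) (c : hom 𝟙 (X ⊗ Y)) A :
  pair_act e A ∘ copair_act c A = lunit A ∘ ((e ∘ c) ⊠ id_hom A) ∘ luniti A.
Proof.
by rewrite !pair_actE !copair_actE ?compA (compr (assocK _ _ _)) compm1 whiskr ?compA.
Qed.

(** The action on a tensor product is the action on its first factor, whiskered. *)
Lemma pair_act_tens Z X (e : hom (Z ⊗ X) 𝟙) A B :
  pair_act e (A ⊗ B) =
  (pair_act e A ⊠ id_hom B) ∘ associ Z (X ⊗ A) B ∘ (id_hom Z ⊠ associ X A B).
Proof.
rewrite !pair_actE !whiskr lunit_tensE -tens_id ?compA.
by rewrite (compr (associ_natural _ _ _)) ?compA (compr (pentagoni _ _ _ _)) ?compA.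
Qed.

(** The left-hand side is the map [Z -> Y] obtained from [e] by bending [X] with
    [c], as in [mate] and in the second identity of [is_duality]. *)
Lemma transpose_act Z X Y (e : hom (Z ⊗ X) 𝟙) (c : hom 𝟙 (X ⊗ Y)) A :
  (lunit Y ∘ (e ⊠ id_hom Y) ∘ associ Z X Y ∘ (id_hom Z ⊠ c) ∘ runiti Z) ⊠ id_hom A =
  pair_act e (Y ⊗ A) ∘ (id_hom Z ⊠ copair_act c A).
Proof.
have E : runiti Z ⊠ id_hom A = associ Z 𝟙 A ∘ (id_hom Z ⊠ luniti A).
  have i : is_iso (runit Z ⊠ id_hom A).
    by apply: is_iso_tens (is_iso_runit _) (is_iso_id _).
  apply: (iso_mono i); rewrite -tens_comp runitiK comp1m tens_id -triangle ?compA.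
  by rewrite (compr (associK _ _ _)) compm1 -whiskl lunitiK tens_id.
rewrite !copair_actE pair_act_tens pair_actE !whiskl !whiskr E ?compA.
rewrite (compr (esym (whiskl _ (associ X Y A) _))) assocK tens_id compm1.
by rewrite (compr (associ_natural _ _ _)) ?compA.
Qed.

(** The triangle identities: tensoring with [Y] is left adjoint to tensoring with
    [X]. *)
Lemma snake_l X Y (e : hom (Y ⊗ X) 𝟙) (c : hom 𝟙 (X ⊗ Y)) A : is_duality e c ->
  (id_hom X ⊠ pair_act e A) ∘ copair_act c (X ⊗ A) = id_hom (X ⊗ A).
Proof.
case=> E _; rewrite !pair_actE !copair_actE !whiskl ?compA.
have F : (id_hom X ⊠ associ Y X A) ∘ assoc X Y (X ⊗ A) =
    assoc X (Y ⊗ X) A ∘ (assoc X Y X ⊠ id_hom A) ∘ associ (X ⊗ Y) X A.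
  apply: (compr_inj (is_iso_assoc (X ⊗ Y) X A)).
  rewrite (compr (assocK _ _ _)) compm1 (compr (pentagon _ _ _ _)) ?compA.
  by rewrite -whiskl assocK tens_id comp1m.
rewrite (compr F) ?compA (compr (esym (assoc_natural _ _ _))) ?compA triangle.
rewrite -tens_id (compr (associ_natural _ _ _)) ?compA -!whiskr E.
by rewrite -lunit_tensE lunitiK tens_id.
Qed.

Lemma snake_r X Y (e : hom (Y ⊗ X) 𝟙) (c : hom 𝟙 (X ⊗ Y)) A : is_duality e c ->
  pair_act e (Y ⊗ A) ∘ (id_hom Y ⊠ copair_act c A) = id_hom (Y ⊗ A).
Proof. by case=> _ E; rewrite -transpose_act E runitiK tens_id. Qed.

(** The unit of an adjunction is determined by its counit through one of the
    triangle identities. *)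
Lemma copair_act_unique X Y (e : hom (Y ⊗ X) 𝟙) (c : hom 𝟙 (X ⊗ Y))
    (psi : forall A, hom A (X ⊗ (Y ⊗ A))) :
  is_duality e c ->
  (forall A B (f : hom A B), (id_hom X ⊠ (id_hom Y ⊠ f)) ∘ psi A = psi B ∘ f) ->
  (forall A, (id_hom X ⊠ pair_act e A) ∘ psi (X ⊗ A) = id_hom (X ⊗ A)) ->
  forall A, psi A = copair_act c A.
Proof.
move=> D nat tri A; rewrite -[RHS]comp1m -[id_hom _]tri.
rewrite (compr (esym (nat _ _ _))) compA -whiskl.
by rewrite (snake_r _ D) tens_id comp1m.
Qed.

(** The two transpositions of the adjunction between tensoring with [Y] and
    tensoring with [X] are injective. *)
Lemma adjunct_inj X Y (e : hom (Y ⊗ X) 𝟙) (c : hom 𝟙 (X ⊗ Y)) A B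
    (f g : hom A (X ⊗ B)) : is_duality e c ->
  pair_act e B ∘ (id_hom Y ⊠ f) = pair_act e B ∘ (id_hom Y ⊠ g) -> f = g.
Proof.
move=> D E; have aux (u : hom A (X ⊗ B)) :
    u = (id_hom X ⊠ (pair_act e B ∘ (id_hom Y ⊠ u))) ∘ copair_act c A.
  by rewrite whiskl (compr (copair_act_natural _ _)) compA (snake_l _ D) comp1m.
by rewrite [f]aux [g]aux E.
Qed.

Lemma coadjunct_inj X Y (e : hom (Y ⊗ X) 𝟙) (c : hom 𝟙 (X ⊗ Y)) A B
    (f g : hom (Y ⊗ A) B) : is_duality e c ->
  (id_hom X ⊠ f) ∘ copair_act c A = (id_hom X ⊠ g) ∘ copair_act c A -> f = g.
Proof.
move=> D E; have aux (u : hom (Y ⊗ A) B) :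
    u = pair_act e B ∘ (id_hom Y ⊠ ((id_hom X ⊠ u) ∘ copair_act c A)).
  by rewrite whiskl compA pair_act_natural (compr (snake_r _ D)) compm1.
by rewrite [f]aux [g]aux E.
Qed.

End MonoidalCategory.

(** * The pivotal dimension is multiplicative *)

Section Duality.
Variables (k : fieldType) (C : fusion_category k).
Implicit Types X Y Z A B : C.

Lemma mate_act Z X (e : hom (Z ⊗ X) (unit_obj C)) A :
  mate e ⊠ id_hom A =
  pair_act e (dual X ⊗ A) ∘ (id_hom Z ⊠ copair_act (coev X) A).
Proof. exact: transpose_act. Qed.

Lemma ev_mate Z X (e : hom (Z ⊗ X) (unit_obj C)) :
  ev X ∘ (mate e ⊠ id_hom X) = e.
Proof.
apply: pair_act_inj => A; rewrite pair_act_comp tens_id mate_act ?compA.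
rewrite -(pair_act_natural e (pair_act (ev X) A)) -compA -whiskl.
by rewrite (snake_l _ (dualP X)) tens_id compm1.
Qed.

Lemma ev_inj Z X (f g : hom Z (dual X)) :
  ev X ∘ (f ⊠ id_hom X) = ev X ∘ (g ⊠ id_hom X) -> f = g.
Proof.
move=> E; apply: unit_whiskr_inj.
have aux (u : hom Z (dual X)) A : u ⊠ id_hom A =
    pair_act (ev X ∘ (u ⊠ id_hom X)) (dual X ⊗ A)
      ∘ (id_hom Z ⊠ copair_act (coev X) A).
  rewrite pair_act_comp tens_id -compA tens_lr -(tens_rl u (copair_act _ _)) compA.
  by rewrite (snake_r _ (dualP X)) comp1m.
by rewrite (aux f) (aux g) E.
Qed.

Lemma ev_dualm X Y (f : hom X Y) :
  ev X ∘ (dualm f ⊠ id_hom X) = ev Y ∘ (id_hom (dual Y) ⊠ f).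
Proof. exact: ev_mate. Qed.

(** [dual_tens] is the transpose of the nested pairing of [dual Y ⊗ dual X] with
    [X ⊗ Y]; this is the natural transformation which that pairing induces. *)
Lemma ev_dual_tens X Y A :
  pair_act (ev (X ⊗ Y) ∘ (dual_tens X Y ⊠ id_hom (X ⊗ Y))) A =
  pair_act (ev Y) A ∘ (id_hom (dual Y) ⊠ pair_act (ev X) (Y ⊗ A))
    ∘ (id_hom (dual Y) ⊠ (id_hom (dual X) ⊠ assoc X Y A))
    ∘ assoc (dual Y) (dual X) ((X ⊗ Y) ⊗ A).
Proof.
rewrite ev_mate -(pair_actE (ev X) Y) pair_act_tens !whiskl ?compA.
rewrite (compr (esym (whiskl _ _ (id_hom _ ⊠ assoc X Y A)))) -whiskl assocK.
rewrite !tens_id compm1 (pair_actE (ev Y)) pair_actE !whiskr ?compA.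
rewrite (compr (associ_natural _ _ _)) ?compA.
have E : (associ _ _ _ ∘ (id_hom (dual Y) ⊠ associ _ _ _) ∘ assoc _ _ _) =
   (assoc (dual Y) (dual X) (X ⊗ Y) ⊠ id_hom A) ∘ associ _ _ _.
  have i : is_iso (associ (dual Y) (dual X) (X ⊗ Y) ⊠ id_hom A).
    exact: is_iso_tens (is_iso_associ _ _ _) (is_iso_id _).
  apply: (iso_mono i); rewrite ?compA -pentagoni -whiskr assocK tens_id comp1m.
  by rewrite -compA assocK compm1.
by rewrite (compr3 E) ?compA.
Qed.

End Duality.

Section PivotalDimension.
Variables (k : closedFieldType) (C : fusion_category k) (a : pivotal_structure C).
Implicit Types X Y Z A B : C.

Lemma unit_scalarE (f : hom (unit_obj C) (unit_obj C)) :
  unit_scalar f *: id_hom (unit_obj C) = f.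
Proof.
have [c ->] := schur_scalar (fus_abelian C) f (unit_simple C).
rewrite /unit_scalar linearZ /=.
have fr : free [tuple id_hom (unit_obj C)].
  by rewrite seq1_free simple_id_nz //; apply: unit_simple.
by have := coord_free ord0 ord0 fr; rewrite /= => ->; rewrite mulr1.
Qed.

(** The evaluation on the other side that the pivotal structure provides. *)
Definition pev X : hom (X ⊗ dual X) (unit_obj C) :=
  ev (dual X) ∘ (a X ⊠ id_hom (dual X)).

Lemma pdim_act X A :
  pair_act (pev X) A ∘ copair_act (coev X) A = pdim a X *: id_hom A.
Proof.
rewrite pair_copair /pdim /ptrace compm1 -/(pev X) -[pev X ∘ coev X]unit_scalarE.
by rewrite tensZm compmZ compZm tens_id compm1 lunitiK unit_scalarE.
Qed.

Lemma ev_dual_comp X Y (f : hom X Y) Z (g : hom Z (dual Y)) :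
  ev X ∘ ((dualm f ∘ g) ⊠ id_hom X) = ev Y ∘ (g ⊠ f).
Proof. by rewrite whiskr compA ev_dualm -compA tens_rl. Qed.

Lemma dualm_comp X Y Z (f : hom X Y) (g : hom Y Z) :
  dualm f ∘ dualm g = dualm (g ∘ f).
Proof.
by apply: ev_inj; rewrite ev_dual_comp ev_dualm whiskl compA -ev_dualm -compA tens_lr.
Qed.

Lemma dualm_id X : dualm (id_hom X) = id_hom (dual X).
Proof. by apply: ev_inj; rewrite ev_dualm. Qed.

(** An isomorphism [f], together with the dual of its inverse, carries the
    coevaluation of [X] to that of [Y], and pulls [pev Y] back to [pev X]. *)
Lemma pdim_iso X Y : isomorphic X Y -> pdim a X = pdim a Y.
Proof.
move=> [f [f' [f'f ff']]].
have cY A : (f ⊠ (dualm f' ⊠ id_hom A)) ∘ copair_act (coev X) A = copair_act (coev Y) A.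
  move: A; apply: (copair_act_unique (dualP Y)) => [A B u|A] /=.
    rewrite compA -[RHS]compA -copair_act_natural compA -!tens_comp.
    by rewrite !comp1m !compm1.
  rewrite compA.
  have -> : (id_hom Y ⊠ pair_act (ev Y) A) ∘ (f ⊠ (dualm f' ⊠ id_hom (Y ⊗ A))) =
      (f ⊠ id_hom A) ∘ (id_hom X ⊠ pair_act (ev X) A)
        ∘ (id_hom X ⊠ (id_hom (dual X) ⊠ (f' ⊠ id_hom A))).
    rewrite -!tens_comp !comp1m !compm1 -[id_hom (Y ⊗ A)]tens_id -!pair_act_comp.
    by rewrite ev_dualm.
  rewrite (compr (copair_act_natural _ _)) compA (compr (snake_l _ (dualP X))).
  by rewrite compm1 -whiskr ff' tens_id.
have pY : pev Y ∘ (f ⊠ dualm f') = pev X.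
  rewrite /pev -compA -tens_comp comp1m piv_natural -tens_lr compA.
  by rewrite ev_dual_comp -compA -tens_comp compm1 dualm_comp f'f dualm_id.
have E A : pdim a X *: id_hom A = pdim a Y *: id_hom A.
  rewrite -!pdim_act -cY compA -pair_act_comp pY //.
have := E (unit_obj C); move/eqP; rewrite -subr_eq0 -scalerBl scaler_eq0.
by rewrite (negbTE (simple_id_nz (unit_simple C))) orbF subr_eq0 => /eqP.
Qed.

(** Moving [dual_tens] to the other side of the evaluation turns it into its dual,
    which monoidality of the pivotal structure expresses by [dual_tens] again. *)
Lemma pev_tens X Y :
  pev (X ⊗ Y) ∘ (id_hom (X ⊗ Y) ⊠ dual_tens X Y) =
  ev (dual Y ⊗ dual X) ∘ (dual_tens (dual Y) (dual X) ⊠ id_hom (dual Y ⊗ dual X))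
    ∘ ((a X ⊠ a Y) ⊠ id_hom (dual Y ⊗ dual X)).
Proof.
rewrite /pev -!compA -!tens_comp !comp1m !compm1 -piv_tens.
by rewrite ev_dual_comp.
Qed.

(** Both the coevaluation and the pivotal pairing of [X ⊗ Y] are nested ones,
    up to the canonical map from [dual Y ⊗ dual X] to [dual (X ⊗ Y)]. *)
Lemma pdim_tens X Y : pdim a (X ⊗ Y) = pdim a X * pdim a Y.
Proof.
pose nest A : hom A ((X ⊗ Y) ⊗ ((dual Y ⊗ dual X) ⊗ A)) :=
  associ X Y _ ∘ (id_hom X ⊠ (id_hom Y ⊠ associ (dual Y) (dual X) A))
    ∘ (id_hom X ⊠ copair_act (coev Y) (dual X ⊗ A)) ∘ copair_act (coev X) A.
(* The nested coevaluation is natural, and its composite with [dual_tens]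
   satisfies a triangle identity with the evaluation of [X ⊗ Y], which
   characterizes the coevaluation of [X ⊗ Y]. *)
have nest_natural A B (u : hom A B) :
    (id_hom (X ⊗ Y) ⊠ (id_hom (dual Y ⊗ dual X) ⊠ u)) ∘ nest A = nest B ∘ u.
  rewrite /nest -[RHS]compA -copair_act_natural ?compA -(tens_id X Y).
  rewrite -associ_natural (compr (esym (whiskl _ (copair_act _ _) _))).
  rewrite -copair_act_natural whiskl ?compA.
  have E : (id_hom X ⊠ (id_hom Y ⊠ associ (dual Y) (dual X) B))
      ∘ (id_hom X ⊠ (id_hom Y ⊠ (id_hom (dual Y) ⊠ (id_hom (dual X) ⊠ u)))) =
      (id_hom X ⊠ (id_hom Y ⊠ (id_hom (dual Y ⊗ dual X) ⊠ u)))
        ∘ (id_hom X ⊠ (id_hom Y ⊠ associ (dual Y) (dual X) A)).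
    by rewrite -!whiskl associ_natural tens_id.
  by rewrite (compr E) ?compA.
have coev_nest A :
    (id_hom (X ⊗ Y) ⊠ (dual_tens X Y ⊠ id_hom A)) ∘ nest A = copair_act (coev (X ⊗ Y)) A.
  move: A; apply: (copair_act_unique (dualP (X ⊗ Y))) => [A B u|A] /=.
    rewrite compA -[RHS]compA -nest_natural compA -!tens_comp.
    by rewrite !comp1m !compm1.
  rewrite compA -whiskl -[id_hom ((X ⊗ Y) ⊗ A)]tens_id -pair_act_comp ev_dual_tens.
  rewrite /nest ?compA -{1}(tens_id X Y) -associ_natural.
  set m := pair_act (ev Y) A; set v := pair_act (ev X) (Y ⊗ A).
  set M := m ∘ _ ∘ _ ∘ _.
  have E : (id_hom X ⊠ (id_hom Y ⊠ M))
      ∘ (id_hom X ⊠ (id_hom Y ⊠ associ (dual Y) (dual X) ((X ⊗ Y) ⊗ A)))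
      ∘ (id_hom X ⊠ copair_act (coev Y) (dual X ⊗ ((X ⊗ Y) ⊗ A))) =
      id_hom X ⊠ (v ∘ (id_hom (dual X) ⊠ assoc X Y A)).
    rewrite -(whiskl X) -(whiskl X) -(whiskl Y) /M (compr (associK _ _ _)) compm1.
    rewrite -(compA m) -(whiskl (dual Y)) (whiskl Y) -(compA (id_hom Y ⊠ m)).
    by rewrite copair_act_natural compA (snake_l _ (dualP Y)) comp1m.
  rewrite (compr3 E) whiskl ?compA (compr (copair_act_natural _ _)) ?compA.
  by rewrite (compr (snake_l _ (dualP X))) compm1 assocK tens_id.
suff : pdim a (X ⊗ Y) *: id_hom (unit_obj C) =
    (pdim a X * pdim a Y) *: id_hom (unit_obj C).
  move/eqP; rewrite -subr_eq0 -scalerBl scaler_eq0.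
  by rewrite (negbTE (simple_id_nz (unit_simple C))) orbF subr_eq0 => /eqP.
move: (unit_obj C) => A.
rewrite -pdim_act -coev_nest compA -pair_act_comp pev_tens pair_act_comp ev_dual_tens.
rewrite /nest ?compA tens_id -tens_id (compr (assoc_natural _ _ _)) ?compA.
rewrite (compr (associK _ _ _)) compm1.
have E : (id_hom (dual (dual X)) ⊠ pair_act (ev (dual Y)) (dual X ⊗ A))
    ∘ (id_hom (dual (dual X)) ⊠ (id_hom (dual (dual Y)) ⊠ assoc (dual Y) (dual X) A))
    ∘ (a X ⊠ (a Y ⊠ id_hom ((dual Y ⊗ dual X) ⊗ A)))
    ∘ (id_hom X ⊠ (id_hom Y ⊠ associ (dual Y) (dual X) A))
    ∘ (id_hom X ⊠ copair_act (coev Y) (dual X ⊗ A)) =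
    pdim a Y *: (a X ⊠ id_hom (dual X ⊗ A)).
  rewrite -!tens_comp !compm1 !comp1m.
  have F : (id_hom (dual (dual Y)) ⊠ assoc (dual Y) (dual X) A)
      ∘ (a Y ⊠ id_hom ((dual Y ⊗ dual X) ⊗ A))
      ∘ (id_hom Y ⊠ associ (dual Y) (dual X) A) = a Y ⊠ id_hom (dual Y ⊗ (dual X ⊗ A)).
    by rewrite -!tens_comp !compm1 !comp1m associK.
  by rewrite (compr3 F) -(tens_id (dual Y)) -pair_act_comp -/(pev Y) pdim_act tensmZ.
rewrite -!(compA (pair_act (ev (dual X)) A)) tens_id E compZm compmZ compA -tens_id.
by rewrite -pair_act_comp -/(pev X) pdim_act scalerA mulrC.
Qed.
End PivotalDimension.

(** * Invertible and simple objects *)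

Section MonoidalInvertible.
Variables (k : fieldType) (C : monoidal_category k).
Implicit Types X Y Z W h : C.

Lemma invertible_whiskl_inj h X Y (f g : hom X Y) :
  invertible h -> id_hom h ⊠ f = id_hom h ⊠ g -> f = g.
Proof.
move=> [h' [_ [u [u' [_ uu']]]]] E; apply: unit_whiskl_inj.
have aux (w : hom X Y) : id_hom (unit_obj C) ⊠ w =
    (u ⊠ id_hom Y) ∘ associ h' h Y ∘ (id_hom h' ⊠ (id_hom h ⊠ w))
      ∘ assoc h' h X ∘ (u' ⊠ id_hom X).
  rewrite (compr (associ_natural _ _ _)) ?compA (compr (assocK _ _ _)) compm1.
  by rewrite -!tens_comp !compm1 comp1m tens_id !compm1 uu'.
by rewrite (aux f) (aux g) E.
Qed.

Lemma invertible_whiskl_nz h X Y (f : hom X Y) :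
  invertible h -> f != 0 -> id_hom h ⊠ f != 0.
Proof.
move=> hi; apply: contra_neq => E; apply: (invertible_whiskl_inj hi).
by rewrite E tensm0.
Qed.

End MonoidalInvertible.

Section SimpleObjects.
Variables (k : closedFieldType) (C : fusion_category k).
Implicit Types X Y Z W A B S T h : C.

Let ab := fus_abelian C.
Let ss := @fus_semisimple _ C.

Lemma coev_nz X : ~ is_zero X -> coev X != 0.
Proof.
move=> Xnz; apply/eqP => c0; apply: Xnz; apply: unit_whiskr_inj.
rewrite tens_id -(snake_l _ (dualP X)) c0 copair_actE.
by rewrite tens0m compm0 comp0m compm0 tens0m.
Qed.

Lemma ev_nz X : ~ is_zero X -> ev X != 0.
Proof.
move=> Xnz; apply/eqP => e0; apply: Xnz; apply: unit_whiskr_inj.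
rewrite tens_id -(snake_l _ (dualP X)) e0 pair_actE.
by rewrite tens0m compm0 comp0m tensm0 comp0m tens0m.
Qed.

(** [Y] is a retract of [dual X ⊗ (X ⊗ Y)], since the evaluation of [X] splits. *)
Lemma tens_nz X Y : ~ is_zero X -> ~ is_zero Y -> ~ is_zero (X ⊗ Y).
Proof.
move=> Xnz Ynz XY0; apply: Ynz.
have [s es] := simple_section ab ss (unit_simple C) (ev_nz Xnz).
apply: unit_whiskl_inj; rewrite -{1}es whiskr.
have -> : ev X ⊠ id_hom Y = luniti Y ∘ pair_act (ev X) Y ∘ assoc _ _ _.
  by rewrite pair_actE ?compA lunitK comp1m (compr (assocK _ _ _)) compm1.
rewrite -[pair_act _ _]compm1 -(tens_id (dual X)) XY0 tensm0.
by rewrite !(compm0, comp0m) tensm0.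
Qed.

(** An endomorphism of [h ⊗ X] becomes an endomorphism of [X], hence a scalar,
    after tensoring with an inverse of [h]. *)
Lemma invertible_simple_tens h X :
  invertible h -> simple_obj X -> simple_obj (h ⊗ X).
Proof.
move=> hi Xs; apply: (scalar_end_simple ab ss) => [hX0|f].
  by case: Xs => []; case; apply: (invertible_whiskl_inj hi); rewrite tens_id hX0 tensm0.
have [h' [hh' h'h]] := hi.
have h'i : invertible h' by exists h.
have XhhX : isomorphic X (h' ⊗ (h ⊗ X)).
  apply: isomorphic_sym; apply: isomorphic_trans (isomorphic_lunit X).
  apply: isomorphic_trans (isomorphic_sym (isomorphic_assoc _ _ _)) _.
  exact: isomorphic_tens (isomorphic_refl _).
have [a fa] := schur_scalar ab (id_hom h' ⊠ f) (isomorphic_simple XhhX Xs).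
by exists a; apply: (invertible_whiskl_inj h'i); rewrite fa tensmZ tens_id.
Qed.

Lemma invertible_simple h : invertible h -> simple_obj h.
Proof.
move=> hi; apply: isomorphic_simple (isomorphic_runit h) _.
exact: invertible_simple_tens (unit_simple C).
Qed.

(** Pairings of [dual X] with [X] correspond to maps from [X] to [X ⊗ 1], which
    form a line by Schur's lemma. *)
Lemma ev_line X (e : hom (dual X ⊗ X) (unit_obj C)) :
  simple_obj X -> exists a, e = a *: ev X.
Proof.
move=> Xs.
have X1s : simple_obj (X ⊗ unit_obj C).
  exact: isomorphic_simple (isomorphic_sym (isomorphic_runit X)) Xs.
pose T (u : hom (dual X ⊗ X) (unit_obj C)) :=
  (id_hom X ⊠ u) ∘ copair_act (coev X) X.
have Tnz : T (ev X) != 0.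
  apply: contra_neq (ev_nz Xs.1) => T0; apply: (coadjunct_inj (dualP X)).
  by rewrite -/(T (ev X)) T0 tensm0 comp0m.
have [a Ta] := schur_line ab (T e) Xs X1s Tnz; exists a.
by apply: (coadjunct_inj (dualP X)); rewrite -/(T e) Ta tensmZ compZm.
Qed.

(** Likewise, maps from [h] to [X ⊗ dual X] correspond to maps from [dual X ⊗ h]
    to [dual X]. *)
Lemma invertible_dual_line h X (u v : hom h (X ⊗ dual X)) :
  simple_obj (dual X ⊗ h) -> simple_obj (dual X) -> u != 0 -> exists a, v = a *: u.
Proof.
move=> hs Xs unz.
pose T (w : hom h (X ⊗ dual X)) := pair_act (ev X) (dual X) ∘ (id_hom (dual X) ⊠ w).
have Tnz : T u != 0.
  apply: contra_neq unz => T0; apply: (adjunct_inj (dualP X)).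
  by rewrite -/(T u) T0 tensm0 compm0.
have [a Ta] := schur_line ab (T v) hs Xs Tnz; exists a.
by apply: (adjunct_inj (dualP X)); rewrite -/(T v) Ta tensmZ compmZ.
Qed.

End SimpleObjects.

(** * The double braiding with an invertible object *)

Section Braided.
Variables (k : closedFieldType) (C : fusion_category k) (c : braiding C).
Implicit Types X Y Z W A B S T h : C.

Let ab := fus_abelian C.
Let ss := @fus_semisimple _ C.

Lemma braid_isomorphic X Y : isomorphic (X ⊗ Y) (Y ⊗ X).
Proof. by exists (c X Y); apply: braid_iso. Qed.

(** A simple object has a simple dual: its endomorphisms correspond to maps from
    the unit to [X ⊗ dual X], hence through the braiding and semisimplicity to
    maps from [dual X ⊗ X] to the unit, and finally to endomorphisms of [X]. *)
Lemma simple_dual X : simple_obj X -> simple_obj (dual X).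
Proof.
move=> Xs; have [s es] := simple_section ab ss (unit_simple C) (ev_nz Xs.1).
have s_line (t : hom (unit_obj C) (dual X ⊗ X)) : exists a, t = a *: s.
  have [a eta] := schur_scalar ab (ev X ∘ t) (unit_simple C); exists a.
  apply/eqP; rewrite -subr_eq0; apply: contraT => tnz.
  have [r rt] := simple_retraction ab ss (unit_simple C) tnz.
  have [b rb] := ev_line r Xs.
  have := simple_id_nz (unit_simple C).
  by rewrite -rt rb compZm compmB compmZ es eta subrr scaler0 eqxx.
have [c' [c'c cc']] := braid_iso c X (dual X).
have [b cb] := s_line (c X (dual X) ∘ coev X).
have bnz : b != 0.
  apply: contra_neq (coev_nz Xs.1) => b0.
  by rewrite -[coev X]comp1m -c'c -compA cb b0 scale0r compm0.
have coev_line (t : hom (unit_obj C) (X ⊗ dual X)) : exists a, t = a *: coev X.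
  have [a ta] := s_line (c X (dual X) ∘ t); exists (a / b).
  rewrite -[t]comp1m -[coev X]comp1m -c'c -!compA ta cb !compmZ scalerA.
  by rewrite divfK.
apply: (scalar_end_simple ab ss) => [dX0|f].
  case/eqP: (ev_nz Xs.1).
  by rewrite -[ev X]compm1 -tens_id dX0 tens0m compm0.
have [a fa] := coev_line ((id_hom X ⊠ f) ∘ coev X); exists a.
apply: unit_whiskr_inj; apply: (coadjunct_inj (dualP X)).
rewrite -copair_act_comp fa !copair_actE tensZm compmZ compZm.
by rewrite tensZm tensmZ compZm !tens_id comp1m.
Qed.

Definition dbraid X Y : hom (X ⊗ Y) (X ⊗ Y) := c Y X ∘ c X Y.

Lemma is_iso_dbraid X Y : is_iso (dbraid X Y).
Proof. exact: iso_comp (braid_iso _ _ _) (braid_iso _ _ _). Qed.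

Lemma dbraid_natural X X' Y Y' (f : hom X X') (g : hom Y Y') :
  dbraid X' Y' ∘ (f ⊠ g) = (f ⊠ g) ∘ dbraid X Y.
Proof. by rewrite /dbraid -compA braid_natural compA braid_natural compA. Qed.

Lemma braid_tensr X Y Z : c X (Y ⊗ Z) =
  associ Y Z X ∘ (id_hom Y ⊠ c X Z) ∘ assoc Y X Z ∘ (c X Y ⊠ id_hom Z) ∘ associ X Y Z.
Proof.
have := congr1 (fun u => associ Y Z X ∘ u ∘ associ X Y Z) (hexagonl c X Y Z).
by rewrite ?compA assocK comp1m -compA associK compm1.
Qed.

Lemma braid_tensl X Y Z : c (X ⊗ Y) Z =
  assoc Z X Y ∘ (c X Z ⊠ id_hom Y) ∘ associ X Z Y ∘ (id_hom X ⊠ c Y Z) ∘ assoc X Y Z.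
Proof.
have := congr1 (fun u => assoc Z X Y ∘ u ∘ assoc X Y Z) (hexagonr c X Y Z).
by rewrite ?compA associK comp1m -compA assocK compm1.
Qed.

(** The hexagons express the double braiding of a product through those of its
    factors; when the inner one is a scalar the outer braidings recombine. *)
Lemma dbraid_tensl X Y Z : dbraid (X ⊗ Y) Z =
  associ X Y Z ∘ (id_hom X ⊠ c Z Y) ∘ assoc X Z Y ∘ (dbraid X Z ⊠ id_hom Y)
    ∘ associ X Z Y ∘ (id_hom X ⊠ c Y Z) ∘ assoc X Y Z.
Proof.
rewrite /dbraid braid_tensr braid_tensl ?compA (compr (assocK _ _ _)) compm1.
by rewrite (compr (esym (whiskr _ _ _))).
Qed.

Lemma dbraid_tensr X Y Z : dbraid X (Y ⊗ Z) =
  assoc X Y Z ∘ (c Y X ⊠ id_hom Z) ∘ associ Y X Z ∘ (id_hom Y ⊠ dbraid X Z)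
    ∘ assoc Y X Z ∘ (c X Y ⊠ id_hom Z) ∘ associ X Y Z.
Proof.
rewrite /dbraid braid_tensr braid_tensl ?compA (compr (associK _ _ _)) compm1.
by rewrite (compr (esym (whiskl _ _ _))).
Qed.

Lemma dbraid_scalar_tensl X Y Z b b' :
  dbraid X Z = b *: id_hom _ -> dbraid Y Z = b' *: id_hom _ ->
  dbraid (X ⊗ Y) Z = (b * b') *: id_hom _.
Proof.
move=> E E'; rewrite dbraid_tensl E tensZm tens_id !(compZm, compmZ) compm1.
rewrite (compr (associK _ _ _)) compm1 (compr (esym (whiskl _ _ _))).
by rewrite -/(dbraid Y Z) E' tensmZ tens_id !(compZm, compmZ) compm1 assocK scalerA.
Qed.

Lemma dbraid_scalar_tensr X Y Z b b' :
  dbraid X Y = b *: id_hom _ -> dbraid X Z = b' *: id_hom _ ->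
  dbraid X (Y ⊗ Z) = (b * b') *: id_hom _.
Proof.
move=> E E'; rewrite dbraid_tensr E' tensmZ tens_id !(compZm, compmZ) compm1.
rewrite (compr (assocK _ _ _)) compm1 (compr (esym (whiskr _ _ _))).
by rewrite -/(dbraid X Y) E tensZm tens_id !(compZm, compmZ) compm1 associK scalerA mulrC.
Qed.

Lemma dbraid_scalar_iso X X' Y Y' b :
  isomorphic X X' -> isomorphic Y Y' ->
  dbraid X Y = b *: id_hom _ -> dbraid X' Y' = b *: id_hom _.
Proof.
move=> [f [f' [_ ff']]] [g [g' [_ gg']]] E.
rewrite -[LHS]compm1 -tens_id -ff' -gg' tens_comp compA dbraid_natural E.
by rewrite compmZ compZm compm1 -tens_comp.
Qed.

Lemma scaler_id_inj X (b b' : k) : ~ is_zero X -> b *: id_hom X = b' *: id_hom X -> b = b'.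
Proof.
move=> /eqP Xnz /eqP; rewrite -subr_eq0 -scalerBl scaler_eq0.
by rewrite (negbTE Xnz) orbF subr_eq0 => /eqP.
Qed.

(** The scalar is idempotent since the unit is isomorphic to its square. *)
Lemma dbraid_unitr X : simple_obj X -> dbraid X (unit_obj C) = id_hom _.
Proof.
move=> Xs; have X1s : simple_obj (X ⊗ unit_obj C).
  exact: isomorphic_simple (isomorphic_sym (isomorphic_runit X)) Xs.
have [b E] := schur_scalar ab (dbraid X (unit_obj C)) X1s.
have E2 := dbraid_scalar_iso (isomorphic_refl X) (isomorphic_runit _)
  (dbraid_scalar_tensr E E).
have bb : b * b = b by apply: (scaler_id_inj X1s.1); rewrite -E -E2.
have bnz : b != 0.
  apply: contra_neq (simple_id_nz X1s) => b0.
  have [d [dE _]] := is_iso_dbraid X (unit_obj C).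
  by rewrite -dE E b0 scale0r compm0.
by rewrite E (mulfI bnz (etrans bb (esym (mulr1 b)))) scale1r.
Qed.

Lemma dbraid_unitl X : simple_obj X -> dbraid (unit_obj C) X = id_hom _.
Proof.
move=> Xs; have [c' [c'c _]] := braid_iso c (unit_obj C) X.
rewrite -[dbraid _ _]comp1m -c'c /dbraid ?compA -(compA c') -/(dbraid X (unit_obj C)).
by rewrite dbraid_unitr // compm1.
Qed.

(** By naturality, and since tensoring with [h] is faithful. *)
Lemma dbraid_scalar_sub h X Y (f : hom X Y) b b' : invertible h -> f != 0 ->
  dbraid h X = b *: id_hom _ -> dbraid h Y = b' *: id_hom _ -> b = b'.
Proof.
move=> hi fnz E E'; have := dbraid_natural (id_hom h) f.
rewrite E E' compZm comp1m compmZ compm1 => /eqP; rewrite -subr_eq0 -scalerBl.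
by rewrite scaler_eq0 (negbTE (invertible_whiskl_nz hi fnz)) orbF subr_eq0 => /eqP.
Qed.

(** The coevaluation is a nonzero map from the unit, whose monodromy is trivial, to
    [X ⊗ dual X]. *)
Lemma dbraid_scalar_dual h X b b' : invertible h -> simple_obj X ->
  dbraid h X = b *: id_hom _ -> dbraid h (dual X) = b' *: id_hom _ -> b * b' = 1.
Proof.
move=> hi Xs E E'; apply/esym.
apply: (dbraid_scalar_sub hi (coev_nz Xs.1)); last exact: dbraid_scalar_tensr E E'.
by rewrite scale1r dbraid_unitr //; apply: invertible_simple.
Qed.

(** If [h ⊗ X] is isomorphic to [X], the double braiding of [X] and [dual X] acts
    on the line of maps from [h] to [X ⊗ dual X].  A generator is obtained from the
    coevaluation either through [h ⊗ X ≅ X] or through [h ⊗ dual X ≅ dual X]; these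
    expressions show that the eigenvalue is the one on the coevaluation times the
    monodromy of [h] with [dual X], respectively with [X]. *)
Lemma dbraid_scalar_fixed h X b b' : invertible h -> simple_obj X ->
  isomorphic (h ⊗ X) X ->
  dbraid h X = b *: id_hom _ -> dbraid h (dual X) = b' *: id_hom _ -> b = b'.
Proof.
move=> hi Xs [f fi] E E'; have Ys := simple_dual Xs.
pose Y := dual X; have hYs : simple_obj (h ⊗ Y) by exact: invertible_simple_tens.
have Yhs : simple_obj (Y ⊗ h) := isomorphic_simple (braid_isomorphic h Y) hYs.
(* [f'] is the dual of [f] up to the braiding: it is the mate of the pairing that
   moves [h] past [dual X], absorbs it into [X] and evaluates. *)
have [f' f'nz] : exists f' : hom (h ⊗ Y) Y, f' != 0.
  pose e := ev X ∘ (id_hom Y ⊠ f) ∘ assoc Y h X ∘ (c h Y ⊠ id_hom X).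
  exists (mate e); apply: contraTneq isT => m0.
  suff : e != 0 by rewrite -(ev_mate e) m0 tens0m compm0 eqxx.
  rewrite /e -!compA; apply: nz_iso (ev_nz Xs.1).
  apply: iso_comp; last exact: is_iso_tens (is_iso_id _) fi.
  by apply: iso_comp (is_iso_assoc _ _ _); apply: is_iso_tens (braid_iso _ _ _) (is_iso_id _).
have f'i := schur_iso ab hYs Ys f'nz.
have cnz := coev_nz Xs.1.
have [l lE] : exists l, dbraid X Y ∘ coev X = l *: coev X.
  by apply: invertible_dual_line cnz => //; apply: isomorphic_simple Ys;
     apply: isomorphic_sym; apply: isomorphic_runit.
have lnz : l != 0.
  have := iso_nz (is_iso_dbraid X Y) cnz.
  by rewrite lE; apply: contra_neq => ->; rewrite scale0r.
pose u := associ h X Y ∘ (id_hom h ⊠ coev X) ∘ runiti h.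
have unz : u != 0.
  apply: nz_iso (is_iso_runiti _) _; apply: iso_nz (is_iso_associ _ _ _) _.
  exact: invertible_whiskl_nz.
(* [v1] absorbs [h] in [X]; [v2] braids [h] past [X] and absorbs it in [dual X]. *)
pose v1 := (f ⊠ id_hom Y) ∘ u.
pose v2 := (id_hom X ⊠ f') ∘ (assoc X h Y ∘ (c h X ⊠ id_hom Y) ∘ u).
have v1nz : v1 != 0 by apply: iso_nz unz; apply: is_iso_tens fi (is_iso_id _).
have v2nz : v2 != 0.
  apply: iso_nz (is_iso_tens (is_iso_id _) f'i) _; apply: iso_nz unz.
  by apply: iso_comp (is_iso_assoc _ _ _); apply: is_iso_tens (braid_iso _ _ _) (is_iso_id _).
have e1 : dbraid X Y ∘ v1 = (b' * l) *: v1.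
  rewrite /v1 compA dbraid_natural dbraid_tensl E' tensZm tens_id !(compZm, compmZ) compm1.
  rewrite (compr (associK _ _ _)) compm1 (compr (esym (whiskl _ _ _))) -/(dbraid X Y).
  rewrite /u ?compA (compr (associK _ _ _)) compm1 (compr (esym (whiskl _ _ _))) lE.
  by rewrite tensmZ !(compZm, compmZ) scalerA.
have e2 : dbraid X Y ∘ v2 = (b * l) *: v2.
  rewrite /v2 compA dbraid_natural dbraid_tensr ?compA (compr (assocK _ _ _)) compm1.
  rewrite (compr (esym (whiskr _ _ _))) -/(dbraid h X) E tensZm tens_id.
  rewrite !(compZm, compmZ) compm1 /u ?compA (compr (associK _ _ _)) compm1.
  rewrite (compr (esym (whiskl _ _ _))) lE tensmZ !(compZm, compmZ) scalerA.
  by rewrite ?compA.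
have [a v2E] := invertible_dual_line v2 Yhs Ys v1nz.
have : (b * l) *: v2 = (b' * l) *: v2 by rewrite -e2 {1}v2E compmZ e1 v2E !scalerA mulrC.
move=> /eqP; rewrite -subr_eq0 -scalerBl scaler_eq0 (negbTE v2nz) orbF subr_eq0.
by move=> /eqP /(mulIf lnz).
Qed.

End Braided.

(** * The pointed and adjoint subcategories *)

Section Subcategories.
Variables (k : closedFieldType) (C : fusion_category k) (c : braiding C).
Implicit Types X Y Z W A B S T U h : C.

Let ab := fus_abelian C.
Let ss := @fus_semisimple _ C.

(** Under the conditions of [constituents_in_subcategory], this is the largest
    fusion subcategory whose simple objects all satisfy [P]. *)
Definition constituents_in (P : C -> Prop) : set C :=
  [set X | forall S (f : hom S X), simple_obj S -> f != 0 -> P S].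

Lemma summand_nz X S (i : hom S X) (p : hom X S) :
  simple_obj S -> p ∘ i = id_hom S -> i != 0.
Proof.
by move=> Ss pi; apply: contra_neq (simple_id_nz Ss) => i0; rewrite -pi i0 compm0.
Qed.

(** By semisimplicity, a constituent of a tensor product, dual, sum or quotient
    comes from constituents of the given objects. *)
Lemma constituents_in_subcategory (P : C -> Prop) :
  (forall S T, isomorphic S T -> P S -> P T) ->
  P (unit_obj C) ->
  (forall S T U (f : hom U (S ⊗ T)), simple_obj S -> simple_obj T ->
     simple_obj U -> f != 0 -> P S -> P T -> P U) ->
  (forall S, simple_obj S -> P S -> P (dual S)) ->
  fusion_subcategory (constituents_in P).
Proof.
move=> Piso P1 Ptens Pdual.
have Pnz S T (f : hom S T) : simple_obj S -> simple_obj T -> f != 0 -> P T -> P S.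
  move=> Ss Ts fnz; apply: Piso; apply: isomorphic_sym.
  exact: schur_isomorphic fnz.
split.
- by move=> S f Ss fnz; apply: Pnz P1; first exact: Ss; [exact: unit_simple|exact: fnz].
- move=> X Y DX DY S f Ss fnz.
  have [n [X_ [Xs [iX [pX [iXK _ sX]]]]]] := ss X.
  have [m [Y_ [Ys [iY [pY [iYK _ sY]]]]]] := ss Y.
  have [i fi] : exists i, (pX i ⊠ id_hom Y) ∘ f != 0.
    apply: (@comp_sum_nz _ C n (fun i => X_ i ⊗ Y) (X ⊗ Y) S (fun i => iX i ⊠ id_hom Y)) fnz.
    rewrite -tens_id -sX tens_suml; apply: eq_bigr => i _.
    by rewrite -tens_comp comp1m.
  have [j fij] : exists j, (id_hom (X_ i) ⊠ pY j) ∘ ((pX i ⊠ id_hom Y) ∘ f) != 0.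
    apply: (@comp_sum_nz _ C m (fun j => X_ i ⊗ Y_ j) _ _ (fun j => id_hom (X_ i) ⊠ iY j)) fi.
    rewrite -tens_id -sY tens_sumr; apply: eq_bigr => j _.
    by rewrite -tens_comp comp1m.
  apply: Ptens fij _ _ => //.
    by apply: DX (summand_nz _ (iXK i)).
  by apply: DY (summand_nz _ (iYK j)).
- move=> X DX S f Ss fnz; have [n [X_ [Xs [iX [pX [iXK _ sX]]]]]] := ss X.
  have enz : ev X ∘ (f ⊠ id_hom X) != 0.
    apply: contra_neq fnz => e0; apply: ev_inj.
    by rewrite e0 tens0m compm0.
  have [i ei] : exists i, ev X ∘ (f ⊠ id_hom X) ∘ (id_hom S ⊠ iX i) != 0.
    apply: (@sum_comp_nz _ C n (fun i => S ⊗ X_ i) _ _ _ (fun i => id_hom S ⊠ pX i)) enz.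
    rewrite -tens_id -sX tens_sumr; apply: eq_bigr => i _.
    by rewrite -tens_comp comp1m.
  have mnz : mate (ev X ∘ (f ⊠ id_hom X) ∘ (id_hom S ⊠ iX i)) != 0.
    by apply: contra_neq ei => m0; rewrite -[LHS]ev_mate m0 tens0m compm0.
  apply: Pnz mnz _ => //; first exact: simple_dual.
  by apply: Pdual => //; apply: DX (summand_nz _ (iXK i)).
- move=> n X_ X DX [iX [pX [iXK _ sX]]] S f Ss fnz.
  have [i fi] := comp_sum_nz sX fnz; exact: DX fi.
- split=> [X Y m mm DY S f Ss fnz|X Y q qe DX S f Ss fnz].
    apply: (DY S (m ∘ f)) => //; apply: contra_neq fnz => mf0.
    by apply: mm; rewrite mf0 compm0.
  have [r rf] := simple_retraction ab ss Ss fnz.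
  have [|s rqs] := @simple_section _ _ ab ss S X (r ∘ q) Ss.
    apply: contra_neq (simple_id_nz Ss) => rq0.
    suff r0 : r = 0 by rewrite -rf r0 comp0m.
    by apply: qe; rewrite rq0 comp0m.
  exact: DX (summand_nz Ss rqs).
Qed.

Lemma invertible_iso X Y : isomorphic X Y -> invertible X -> invertible Y.
Proof.
move=> XY [X' [XX' X'X]]; exists X'; split.
  by apply: isomorphic_trans XX'; apply: isomorphic_tens (isomorphic_refl _);
     apply: isomorphic_sym.
by apply: isomorphic_trans X'X; apply: isomorphic_tens (isomorphic_refl _) _;
   apply: isomorphic_sym.
Qed.

Lemma invertible_dual X : invertible X -> invertible (dual X).
Proof.
move=> Xi; have Xs := invertible_simple Xi.
have XdX : isomorphic (unit_obj C) (X ⊗ dual X).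
  apply: (schur_isomorphic ab (unit_simple C) _ (coev_nz Xs.1)).
  exact: invertible_simple_tens Xi (simple_dual c Xs).
exists X; split; apply: isomorphic_sym => //.
exact: isomorphic_trans XdX (braid_isomorphic c _ _).
Qed.

(** The objects with invertible constituents form a fusion subcategory that
    contains all invertible objects. *)
Lemma pointed_invertible S : simple_obj S -> pointed_part C S -> invertible S.
Proof.
move=> Ss /(_ (constituents_in (@invertible _ C))) H.
apply: (H _ _ S (id_hom S)) => // [|X Xi T f Ts fnz|]; last exact: simple_id_nz.
  apply: constituents_in_subcategory.
  - exact: invertible_iso.
  - exact: invertible_unit.
  - move=> T T' U f _ _ Us fnz Ti T'i; have TT'i := invertible_tens Ti T'i.
    apply: (invertible_iso _ TT'i); apply: isomorphic_sym.
    exact: schur_isomorphic (invertible_simple TT'i) fnz.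
  - by move=> T _; apply: invertible_dual.
apply: (invertible_iso _ Xi); apply: isomorphic_sym.
by apply: schur_isomorphic fnz => //; apply: invertible_simple.
Qed.

(** The monodromies of [h] with [X] and with [dual X] are inverse to each other, so
    that the monodromy is trivial on every constituent of [X ⊗ dual X]. *)
Lemma dbraid_adjoint h S : invertible h -> simple_obj S -> adjoint_part C S ->
  dbraid c h S = id_hom _.
Proof.
move=> hi Ss /(_ (constituents_in (fun S => dbraid c h S = id_hom _))) H.
have scal T : simple_obj T -> exists b, dbraid c h T = b *: id_hom _.
  by move=> Ts; apply: (schur_scalar ab); apply: invertible_simple_tens.
apply: (H _ _ S (id_hom S)) => // [|_ [X Xs ->] T f Ts fnz|]; last exact: simple_id_nz.
  apply: constituents_in_subcategory => /=.
  - move=> T U TU; rewrite -[id_hom (h ⊗ T)]scale1r -[id_hom (h ⊗ U)]scale1r.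
    exact: dbraid_scalar_iso (isomorphic_refl h) TU.
  - exact: dbraid_unitr (invertible_simple hi).
  - move=> T T' U f Ts T's Us fnz; rewrite -[id_hom (h ⊗ T)]scale1r => E.
    rewrite -[id_hom (h ⊗ T')]scale1r => E'; have [b bE] := scal U Us.
    rewrite bE (dbraid_scalar_sub hi fnz bE (dbraid_scalar_tensr E E')).
    by rewrite mulr1 scale1r.
  - move=> T Ts; rewrite -[id_hom (h ⊗ T)]scale1r => E.
    have [b bE] := scal _ (simple_dual c Ts).
    by rewrite bE -[b]mul1r (dbraid_scalar_dual hi Ts E bE) scale1r.
have [b bE] := scal T Ts; have [d dE] := scal X Xs.
have [d' d'E] := scal _ (simple_dual c Xs).
rewrite bE (dbraid_scalar_sub hi fnz bE (dbraid_scalar_tensr dE d'E)).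
by rewrite (dbraid_scalar_dual hi Xs dE d'E) scale1r.
Qed.

End Subcategories.

(** * The monodromy pairing of invertible objects with degrees *)

Section Gradings.
Variables (k : closedFieldType) (C : fusion_category k).
Variables (G : groupType) (C_ : G -> set C) (C_gr : grading C_).
Implicit Types X Y Z S T : C.

Let ab := fus_abelian C.
Let ss := @fus_semisimple _ C.

Lemma grading_iso g X Y : isomorphic X Y -> C_ g X -> C_ g Y.
Proof.
case: C_gr => sums _ _ _ [f [f' [f'f ff']]] CX.
apply: (sums g 1%N (fun _ => X)) => //; exists (fun _ => f), (fun _ => f').
by split=> [//|i j|]; rewrite ?big_ord1 // !ord1 eqxx.
Qed.

(** A homogeneous summand on which the projector is nonzero is the whole of [S]. *)
Lemma simple_homogeneous S : simple_obj S -> exists g, C_ g S.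
Proof.
move=> Ss; have [_ _ decomp _] := C_gr.
have [n [X_ [d [X_d [iX [pX [iXK _ sX]]]]]]] := decomp S.
have [i enz] : exists i, iX i ∘ pX i != 0.
  apply: contrapT => /forallNP e0; case/eqP: (simple_id_nz Ss).
  by rewrite -sX big1 // => i _; have /negP/negPn/eqP := e0 i.
have [e' [e'e _]] := schur_iso ab Ss Ss enz.
have e1 : iX i ∘ pX i = id_hom S.
  have ee : (iX i ∘ pX i) ∘ (iX i ∘ pX i) = iX i ∘ pX i.
    by rewrite ?compA (compr (iXK i)) compm1.
  by rewrite -[LHS]comp1m -e'e -(compA e') ee.
exists (d i); apply: grading_iso (X_d i); exists (iX i), (pX i).
by split; first exact: iXK.
Qed.

Lemma homogeneous_maps g h X Y (f : hom X Y) : f != 0 -> C_ g X -> C_ h Y -> g = h.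
Proof.
case: C_gr => _ orth _ _ fnz Xg Yh; apply/eqP; apply: contra_neqT fnz => gh.
exact: orth gh Xg Yh.
Qed.

Lemma simple_sub_homogeneous g S Y (f : hom S Y) :
  simple_obj S -> f != 0 -> C_ g Y -> C_ g S.
Proof.
move=> Ss fnz Yg; have [h Sh] := simple_homogeneous Ss.
by rewrite -(homogeneous_maps fnz Sh Yg).
Qed.

End Gradings.

Section UniversalGrading.
Variables (k : closedFieldType) (C : fusion_category k) (c : braiding C).
Variables (G : groupType) (C_ : G -> set C) (C_univ : universal_grading C_).
Implicit Types (X Y Z S T h : C) (u v : G).

Let ab := fus_abelian C.
Let ss := @fus_semisimple _ C.
Let C_gr : grading C_ := C_univ.1.1.

Lemma homogeneous_simple u : exists2 S, simple_obj S & C_ u S.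
Proof.
have [_ /(_ u) [X Xu Xnz]] := C_univ.1.
have [S Ss [f fnz]] := simple_constituent ss Xnz.
by exists S => //; apply: simple_sub_homogeneous fnz Xu.
Qed.

Lemma dbraid_scalar h S : invertible h -> simple_obj S ->
  exists b, dbraid c h S = b *: id_hom _.
Proof. by move=> hi Ss; apply: (schur_scalar ab); apply: invertible_simple_tens. Qed.

(** Two simple objects [S] and [X] of the same degree have the same monodromy with
    [h], since that with [S ⊗ dual X], an object of the adjoint part, is trivial. *)
Lemma monodromy_exists h u : invertible h ->
  exists b, forall S, simple_obj S -> C_ u S -> dbraid c h S = b *: id_hom _.
Proof.
move=> hi; have [X Xs Xu] := homogeneous_simple u.
have [b bE] := dbraid_scalar hi Xs; exists b => S Ss Su.
have Ds := simple_dual c Xs; have [v Dv] := simple_homogeneous C_gr Ds.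
have [_ _ _ mul] := C_gr.
have C1 : C_ 1%g (unit_obj C) by rewrite C_univ.2 => D [].
have uv := homogeneous_maps C_gr (coev_nz Xs.1) C1 (mul _ _ _ _ Xu Dv).
have [T Ts [f fnz]] := simple_constituent ss (tens_nz Ss.1 Ds.1).
have Tad : adjoint_part C T.
  rewrite -C_univ.2 uv; apply: simple_sub_homogeneous fnz _ => //.
  exact: mul Su Dv.
have [d dE] := dbraid_scalar hi Ds; have [b' b'E] := dbraid_scalar hi Ss.
have b'd : 1 = b' * d.
  apply: (dbraid_scalar_sub (c := c) hi fnz); last exact: dbraid_scalar_tensr b'E dE.
  by rewrite scale1r; apply: dbraid_adjoint.
have bd := dbraid_scalar_dual hi Xs bE dE.
have dnz : d != 0 by apply: contra_eq_neq bd => ->; rewrite mulr0 eq_sym oner_neq0.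
by rewrite b'E; congr (_ *: _); apply: (mulIf dnz); rewrite bd.
Qed.

Definition monodromy (h : Pic C) u : k :=
  sval (cid (monodromy_exists u (Pic_reprP h))).

Lemma monodromyP (h : Pic C) u S : simple_obj S -> C_ u S ->
  dbraid c (Pic_repr h) S = monodromy h u *: id_hom _.
Proof. by rewrite /monodromy; case: cid => b /= H; apply: H. Qed.

Lemma monodromyMl (h h' : Pic C) u : monodromy (h * h')%g u = monodromy h u * monodromy h' u.
Proof.
have [S Ss Su] := homogeneous_simple u.
apply: (@scaler_id_inj _ C (Pic_repr (h * h')%g ⊗ S)).
  by case: (invertible_simple_tens (Pic_reprP (h * h')%g) Ss).
rewrite -monodromyP //; apply: dbraid_scalar_iso (isomorphic_refl S) _.
  apply: isomorphic_sym (Pic_mul_repr h h').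
by apply: dbraid_scalar_tensl; apply: monodromyP.
Qed.

Lemma monodromyMr (h : Pic C) u v : monodromy h (u * v)%g = monodromy h u * monodromy h v.
Proof.
have [X Xs Xu] := homogeneous_simple u; have [Y Ys Yv] := homogeneous_simple v.
have [S Ss [f fnz]] := simple_constituent ss (tens_nz Xs.1 Ys.1).
have [_ _ _ mul] := C_gr; have hi := Pic_reprP h.
apply: (dbraid_scalar_sub (c := c) hi fnz).
  by apply: monodromyP => //; apply: simple_sub_homogeneous fnz (mul _ _ _ _ Xu Yv).
by apply: dbraid_scalar_tensr; apply: monodromyP.
Qed.

End UniversalGrading.

(** * The finite group of invertible objects *)

Section FinitePic.
Variables (k : closedFieldType) (C : fusion_category k).

Definition Pic_index (h : Pic C) : 'I_(rank C) :=
  sval (cid (irr_surj (invertible_simple (Pic_reprP h)))).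

Lemma Pic_indexP (h : Pic C) : isomorphic (Pic_repr h) (irr (Pic_index h)).
Proof. exact: svalP (cid (irr_surj (invertible_simple (Pic_reprP h)))). Qed.

Lemma Pic_index_invertible (h : Pic C) : invertible (irr (Pic_index h)).
Proof. exact: invertible_iso (Pic_indexP h) (Pic_reprP h). Qed.

Definition Pic_of_index (i : 'I_(rank C)) : option (Pic C) :=
  if pselect (invertible (irr i)) is left hi then Some (Pic_class hi) else None.

Lemma Pic_indexK : pcancel Pic_index Pic_of_index.
Proof.
move=> h; rewrite /Pic_of_index; case: pselect => [hi|]; last first.
  by case; apply: Pic_index_invertible.
congr Some; apply: Pic_eq; apply: isomorphic_trans (Pic_class_repr _) _.
exact: isomorphic_sym (Pic_indexP h).
Qed.

Lemma Pic_index_surj i : invertible (irr i) -> exists h, i = Pic_index h.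
Proof.
move=> hi; exists (Pic_class hi); apply: irr_inj.
exact: isomorphic_trans (isomorphic_sym (Pic_class_repr hi)) (Pic_indexP _).
Qed.

HB.instance Definition _ := PCanIsCountable Pic_indexK.
HB.instance Definition _ : isFinite (Pic C) := PCanIsFinite Pic_indexK.

End FinitePic.

(** * Characters of finite groups *)

Section Characters.
Variables (G : finGroupType) (F : fieldType).

(** Translating by [x] multiplies the product of all values by [f x ^+ #|G|]. *)
Lemma char_expn_card (f : G -> F) x :
  {morph f : y z / (y * z)%g >-> y * z} -> (forall y, f y != 0) -> f x ^+ #|G| = 1.
Proof.
move=> fM fnz.
have pnz : \prod_y f y != 0 by apply/prodf_neq0.
apply: (mulIf pnz); rewrite mul1r [RHS](reindex_inj (mulgI x)) /=.
by under [RHS]eq_bigr do rewrite fM; rewrite big_split prodr_const.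
Qed.

(** Translating by [x] multiplies the sum of all values by [f x]. *)
Lemma char_sum (f : G -> F) x :
  {morph f : y z / (y * z)%g >-> y * z} -> f x != 1 -> \sum_y f y = 0.
Proof.
move=> fM fx; have E : f x * (\sum_y f y) = \sum_y f y.
  by rewrite [RHS](reindex_inj (mulgI x)) mulr_sumr; apply: eq_bigr => y _; rewrite fM.
by apply: (mulfI (_ : f x - 1 != 0)); rewrite ?subr_eq0 // mulrBl E mul1r subrr mulr0.
Qed.

(** The sum of all values is [#|G|] when computed along the left argument; along
    the right argument it is [#|G|] times the order of the right kernel. *)
Lemma bichar_nondegenerate (b : G -> G -> F) : [pchar F] =i pred0 ->
  (forall x y z, b (x * y)%g z = b x z * b y z) ->
  (forall x y z, b x (y * z)%g = b x y * b x z) ->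
  (forall x y, b x y != 0) ->
  (forall x, (forall y, b x y = 1) -> x = 1%g) ->
  forall y, (forall x, b x y = 1) -> y = 1%g.
Proof.
move=> /pcharf0P char0 bMl bMr bnz ker1 y yK.
have b1 x : b x 1%g = 1.
  by apply: (mulfI (bnz x 1%g)); rewrite -bMr mulg1 mulr1.
have b1l x : b 1%g x = 1.
  by apply: (mulfI (bnz 1%g x)); rewrite -bMl mulg1 mulr1.
have sum1 (f : G -> F) : (forall x, f x = 1) -> \sum_x f x = #|G|%:R.
  by move=> f1; under eq_bigr do rewrite f1; rewrite sumr_const.
pose K := [set z | [forall x, b x z == 1]]%SET.
have total : \sum_x \sum_z b x z = #|G|%:R.
  rewrite (bigD1 1%g) //= sum1 // big1 ?addr0 // => x xn1.
  have [z xz] : exists z, b x z != 1.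
    apply: contrapT => /forallNP xK; case/eqP: xn1; apply: ker1 => z.
    by have /negP/negPn/eqP := xK z.
  by apply: char_sum xz; apply: bMr.
have : \sum_z \sum_x b x z = \sum_(z in K) #|G|%:R.
  rewrite [RHS]big_mkcond; apply: eq_bigr => z _; rewrite inE.
  case: ifPn => [/forallP zK|/forallPn[x xz]]; first by apply: sum1 => x; apply/eqP.
  by apply: (char_sum (f := b ^~ z)) xz => u v; apply: bMl.
rewrite exchange_big /= total sumr_const -mulrnA => /esym/eqP.
have K1 : 1%g \in K by rewrite inE; apply/forallP => x; rewrite b1.
have yinK : y \in K by rewrite inE; apply/forallP => x; rewrite yK.
have G0 : (0 < #|G|)%N by apply/card_gt0P; exists 1%g.
have leG : (#|G| <= #|G| * #|K|)%N by rewrite leq_pmulr //; apply/card_gt0P; exists 1%g.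
rewrite -subr_eq0 -natrB // char0 subn_eq0 -{2}[#|G|]muln1 leq_pmul2l //.
by move=> /card_le1_eqP /(_ y 1%g yinK K1).
Qed.

End Characters.

Lemma odd_root_of_sqr1 (F : fieldType) (x : F) n : odd n -> x ^+ 2 = 1 -> x ^+ n = 1 -> x = 1.
Proof.
move=> on x2 <-; rewrite -(odd_double_half n) on -muln2 mulnC exprD exprM x2 expr1n.
by rewrite mulr1.
Qed.

(** * Consequences of the invertibility of the S-matrix *)

Section Modular.
Variables (k : closedFieldType) (C : modular_category k).
Implicit Types (X Y Z S T : C) (h : Pic C).

Let ab := fus_abelian C.
Let c := mod_braiding C.
Let a := mod_pivotal C.

Lemma S_matrix_transparent i : (forall j, dbraid c (irr i) (irr j) = id_hom _) ->
  row i (S_matrix c a) = qdim (irr i) *: \row_j qdim (irr j).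
Proof.
move=> E; apply/rowP => j; rewrite ![in LHS]mxE -/(dbraid c (irr i) (irr j)) E.
by rewrite !mxE -pdim_tens.
Qed.

Lemma unit_index_transparent j :
  dbraid c (irr (Pic_index (1%g : Pic C))) (irr j) = id_hom _.
Proof.
rewrite -[RHS]scale1r; apply: dbraid_scalar_iso (isomorphic_refl (irr j)) _.
  apply: isomorphic_trans (isomorphic_sym (Pic_class_repr _)) (Pic_indexP _).
by rewrite scale1r dbraid_unitl //; apply: irr_simple.
Qed.

Lemma S_matrix_row_inj (u : 'rV[k]_(rank C)) : u *m S_matrix c a = 0 -> u = 0.
Proof. by move=> uS; rewrite -[u](mulmxK (S_matrix_unit C)) uS mul0mx. Qed.

Lemma qdim_unit_nz : qdim (irr (Pic_index (1%g : Pic C))) != 0.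
Proof.
set i := Pic_index _; apply/eqP => d0.
have : delta_mx 0 i = 0 :> 'rV[k]_(rank C).
  apply: S_matrix_row_inj; rewrite -rowE S_matrix_transparent ?d0 ?scale0r //.
  exact: unit_index_transparent.
by move=> /rowP /(_ i); rewrite !mxE !eqxx => /eqP; rewrite oner_eq0.
Qed.

(** The rows of the S-matrix at [h] and at the unit are both multiples of the row of
    dimensions, so they cannot be two different rows of an invertible matrix. *)
Lemma transparent_Pic_eq1 h :
  (forall j, dbraid c (irr (Pic_index h)) (irr j) = id_hom _) -> h = 1%g.
Proof.
move=> Eh; apply: (pcan_inj (@Pic_indexK _ C)); apply/eqP.
apply: contraT => hn1; set i := Pic_index h in Eh hn1 *; set i1 := Pic_index 1%g in hn1 *.
have /rowP/(_ i) : qdim (irr i1) *: delta_mx 0 i - qdim (irr i) *: delta_mx 0 i1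
    = 0 :> 'rV[k]_(rank C).
  apply: S_matrix_row_inj; rewrite mulmxBl -!scalemxAl -!rowE !S_matrix_transparent //.
    by rewrite !scalerA mulrC subrr.
  exact: unit_index_transparent.
rewrite !mxE !eqxx (negbTE hn1) /= mulr1 mulr0 subr0 => /eqP.
by rewrite (negbTE qdim_unit_nz).
Qed.

Lemma qdim_iso X Y : isomorphic X Y -> qdim X = qdim Y.
Proof. exact: pdim_iso. Qed.

(** The dimension is a character of the group of invertible objects; its values
    square to 1 because [h] and its dual, which is its inverse, have the same
    dimension. *)
Lemma qdim_Pic_repr h : odd #|{: Pic C}| -> qdim (Pic_repr h) = 1.
Proof.
pose d (h' : Pic C) := qdim (Pic_repr h').
have dM : {morph d : x y / (x * y)%g >-> x * y}.
  by move=> x y; rewrite /d (qdim_iso (Pic_mul_repr x y)) /qdim pdim_tens.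
have d1nz : d 1%g != 0 by rewrite /d (qdim_iso (Pic_indexP _)) qdim_unit_nz.
have d1 : d 1%g = 1 by apply: (mulfI d1nz); rewrite -dM mulg1 mulr1.
have dnz x : d x != 0.
  by apply: contra_neq d1nz => dx; rewrite -(mulgV x) dM dx mul0r.
move=> oddG; apply: (odd_root_of_sqr1 oddG (x := d h)); last exact: char_expn_card.
have dual_dim : qdim (Pic_repr h) = qdim (dual (Pic_repr h)) := mod_spherical _.
rewrite expr2 {2}/d dual_dim -[_ * _]pdim_tens -d1.
apply: pdim_iso; apply: isomorphic_trans (isomorphic_sym (Pic_class_repr _)).
apply: isomorphic_sym; have hi := Pic_reprP h; have hs := invertible_simple hi.
apply: (schur_isomorphic ab (unit_simple C) _ (coev_nz hs.1)).
exact: invertible_simple_tens hi (simple_dual c hs).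
Qed.

(** * The action on simple objects by tensoring *)

Lemma simple_tens_Pic j h : simple_obj (irr j ⊗ Pic_repr h).
Proof.
apply: isomorphic_simple (braid_isomorphic c _ _) _.
by apply: invertible_simple_tens (Pic_reprP h) (irr_simple j).
Qed.

(** Tensoring takes place on the right because group actions are right actions. *)
Definition irr_shift (j : 'I_(rank C)) h : 'I_(rank C) :=
  sval (cid (irr_surj (simple_tens_Pic j h))).

Lemma irr_shiftP j h : isomorphic (irr j ⊗ Pic_repr h) (irr (irr_shift j h)).
Proof. exact: svalP (cid (irr_surj (simple_tens_Pic j h))). Qed.

Lemma irr_shift1 j : irr_shift j 1%g = j.
Proof.
apply: irr_inj; apply: isomorphic_trans (isomorphic_sym (irr_shiftP j 1%g)) _.
apply: isomorphic_trans (isomorphic_runit (irr j)).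
exact: isomorphic_tens (isomorphic_refl _) (Pic_class_repr _).
Qed.

Lemma irr_shiftM j h h' : irr_shift j (h * h')%g = irr_shift (irr_shift j h) h'.
Proof.
apply: irr_inj; apply: isomorphic_trans (isomorphic_sym (irr_shiftP _ _)) _.
apply: isomorphic_trans (irr_shiftP _ _).
apply: isomorphic_trans (isomorphic_tens (irr_shiftP j h) (isomorphic_refl _)).
apply: isomorphic_trans (isomorphic_sym (isomorphic_assoc _ _ _)).
exact: isomorphic_tens (isomorphic_refl _) (Pic_mul_repr h h').
Qed.

Definition shift_action := TotalAction irr_shift1 irr_shiftM.

Lemma dim_hom_irr i S : simple_obj S ->
  \dim {: hom (irr i) S} = `[< isomorphic (irr i) S >] :> nat.
Proof.
move=> Ss; have is_ := irr_simple i; case: asboolP => [[f fi]|niso].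
  have fnz : f != 0.
    by rewrite -[f]compm1; apply: iso_nz fi (simple_id_nz is_).
  suff -> : fullv = <[f]>%VS by rewrite dim_vline fnz.
  apply/vspaceP => g; rewrite memvf; apply/esym/vlineP.
  exact: (schur_line ab g is_ Ss fnz).
suff -> : fullv = 0%VS :> {vspace hom (irr i) S} by rewrite dimv0.
apply/vspaceP => g; rewrite memvf memv0; apply/esym; apply: contraT => gnz.
by case: niso; exists g; apply: schur_iso gnz.
Qed.

Lemma fusion_matrix_Pic (R : realType) h :
  fusion_matrix R (Pic_index h) = \matrix_(j, l) (l == irr_shift j h)%:R.
Proof.
apply/matrixP => j l; rewrite !mxE dim_hom_irr; last first.
  exact: invertible_simple_tens (Pic_index_invertible h) (irr_simple j).
congr (_%:R); congr nat_of_bool; apply/asboolP/eqP => [E|->].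
  apply: irr_inj; apply: isomorphic_trans E _; apply: isomorphic_trans (irr_shiftP j h).
  apply: isomorphic_trans (braid_isomorphic c _ _) _.
  exact: isomorphic_tens (isomorphic_refl _) (isomorphic_sym (Pic_indexP h)).
apply: isomorphic_trans (isomorphic_sym (irr_shiftP j h)) _.
apply: isomorphic_trans (braid_isomorphic c _ _) _.
exact: isomorphic_tens (Pic_indexP h) (isomorphic_refl _).
Qed.

(** The fusion matrix is a permutation matrix.  Iterating it [#|Pic C|] times shows
    that its eigenvalues are roots of unity, and 1 is the only nonnegative one. *)
Lemma FPdim_Pic (R : realType) h : FPdim R (Pic_index h) = 1.
Proof.
rewrite /FPdim; set E := [set x | _]; suff -> : E = [set 1] by rewrite sup1.
have coordE (v : 'rV[R]_(rank C)) j :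
    (v *m fusion_matrix R (Pic_index h)) 0 (irr_shift j h) = v 0 j.
  rewrite fusion_matrix_Pic mxE (bigD1 j) //= mxE eqxx mulr1 big1 ?addr0 // => i inj.
  rewrite mxE; case: eqP => [/(can_inj (actK shift_action h)) ji|]; last by rewrite mulr0.
  by rewrite ji eqxx in inj.
apply/seteqP; split=> [x [x0 /eigenvalueP[v vx vnz]]|_ ->].
  have [j vj] : exists j, v 0 j != 0.
    apply: contrapT => /forallNP v0; case/eqP: vnz; apply/rowP => j; rewrite mxE.
    by have /negP/negPn/eqP := v0 j.
  have iterE n : v 0 j = x ^+ n * v 0 (irr_shift j (h ^+ n)%g).
    elim: n => [|n ->]; first by rewrite expr0 mul1r irr_shift1.
    by rewrite -coordE vx mxE mulrA -exprSr expgSr irr_shiftM.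
  have := iterE #|{: Pic C}|; rewrite -cardsT expg_cardG ?inE // irr_shift1.
  rewrite -{1}[v 0 j]mul1r => /(mulIf vj)/esym/eqP.
  by rewrite pexpr_eq1 ?cardG_gt0 // => /eqP.
split; first exact: ler01.
apply/eigenvalueP; exists (const_mx 1).
  apply/rowP => j; rewrite -[j](actKV shift_action h) /= coordE !mxE mulr1 //.
apply/eqP => /rowP/(_ (Pic_index h)); rewrite !mxE; apply/eqP; exact: oner_neq0.
Qed.

Lemma FPdim_pointed (R : realType) : FPdim_sub R (pointed_part C) = #|{: Pic C}|%:R.
Proof.
rewrite /FPdim_sub (eq_bigl [in codom (@Pic_index k C)]); last first.
  move=> i; apply/asboolP/codomP => [pi|[h ->]].
    exact: Pic_index_surj (pointed_invertible c (irr_simple i) pi).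
  by move=> D _; apply; apply: Pic_index_invertible.
rewrite (eq_bigr (fun => 1)) => [|i /codomP[h ->]]; last by rewrite FPdim_Pic expr1n.
rewrite sumr_const; congr (_%:R); rewrite card_codom //.
exact: pcan_inj (@Pic_indexK _ C).
Qed.

End Modular.

(** * Fixed points have trivial degree *)

Section Fixpoints.
Variables (k : closedFieldType) (C : modular_category k) (C_ : Pic C -> set C).
Hypothesis C_univ : universal_grading C_.
Hypothesis odd_Pic : odd #|{: Pic C}|.
Implicit Types (X Y Z S T : C) (h : Pic C).

Let c := mod_braiding C.
Local Notation b := (monodromy c C_univ).

Lemma monodromy_nz h u : b h u != 0.
Proof.
have [S Ss Su] := homogeneous_simple C_univ u.
have hSs := invertible_simple_tens (Pic_reprP h) Ss.
apply: contra_neq (simple_id_nz hSs) => b0.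
have [d [dE _]] := is_iso_dbraid c (Pic_repr h) S.
by rewrite -dE (monodromyP c C_univ h Ss Su) b0 scale0r compm0.
Qed.

Lemma monodromy_nondegenerate (char_k : [pchar k] =i pred0) u :
  (forall h, b h u = 1) -> u = 1%g.
Proof.
apply: (bichar_nondegenerate char_k (monodromyMl c C_univ) (monodromyMr c C_univ)
  monodromy_nz) => h bh1.
apply: transparent_Pic_eq1 => j; rewrite -[RHS]scale1r.
have [v jv] := simple_homogeneous C_univ.1.1 (irr_simple j).
apply: dbraid_scalar_iso (Pic_indexP h) (isomorphic_refl _) _.
by rewrite (monodromyP c C_univ h (irr_simple j) jv) bh1.
Qed.

Lemma fixed_degree1 (char_k : [pchar k] =i pred0) u j :
  C_ u (irr j) -> (forall h, irr_shift j h = j) -> u = 1%g.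
Proof.
move=> ju jfix; apply: monodromy_nondegenerate => // h.
have hi := Pic_reprP h; have js := irr_simple j.
have hj : isomorphic (Pic_repr h ⊗ irr j) (irr j).
  apply: isomorphic_trans (braid_isomorphic c _ _) _.
  by have := irr_shiftP j h; rewrite jfix.
have E := monodromyP c C_univ h js ju.
have [b' E'] := dbraid_scalar c hi (simple_dual c js).
apply: (odd_root_of_sqr1 odd_Pic); last first.
  apply: (char_expn_card (f := b ^~ u)) => [x y|x]; first exact: monodromyMl.
  exact: monodromy_nz.
by rewrite expr2 {2}(dbraid_scalar_fixed hi js hj E E') (dbraid_scalar_dual hi js E E').
Qed.

End Fixpoints.

Theorem proposition5p7 (R : realType) (k : closedFieldType)
    (char_k : [pchar k] =i pred0)
    (iota : k -> R[i]) (iota_emb : algebraic_embedding iota)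
    (p : nat) (p_prime : prime p) (p_odd : odd p) (a : R[i])
    (C : modular_category k)
    (C_nonpointed : ~ pointed C)
    (C_pt_ad : pointed_part C `<=` adjoint_part C)
    (C_pt_dim : exists n : nat, FPdim_sub R (pointed_part C) = (p ^ n)%:R)
    (C_ : Pic C -> set C) (C_univ : universal_grading C_)
    (g : Pic C) (g_neq1 : g != 1%g) :
  (p %| #|[set i : 'I_(rank C) |
            `[< C_ g (irr i) >] && (iota (qdim (irr i)) == a)]%SET|)%N.
Proof.
have [n /eqP] := C_pt_dim; rewrite FPdim_pointed eqr_nat => /eqP cardG.
have oddG : odd #|{: Pic C}| by rewrite cardG oddX p_odd orbT.
set A := [set i | _]%SET.
have pG : (p.-group [set: Pic C]%SET)%g by rewrite /pgroup cardsT cardG pnatX pnat_id.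
have shiftA j h : j \in A -> irr_shift j h \in A.
  rewrite !inE => /andP[/asboolP jg /eqP <-]; apply/andP; split.
    apply/asboolP; apply: (grading_iso C_univ.1.1 (irr_shiftP j h)).
    have [_ _ _ mul] := C_univ.1.1; rewrite -[g]mulg1; apply: mul => //.
    by rewrite C_univ.2; apply: C_pt_ad => D _; apply; apply: Pic_reprP.
  rewrite -(qdim_iso (irr_shiftP j h)).
  by rewrite /qdim pdim_tens -/(qdim (Pic_repr h)) qdim_Pic_repr // mulr1.
have act : [acts [set: Pic C]%SET, on A | shift_action C]%g.
  apply/actsP => h _ j; apply/idP/idP => [|jA]; last exact: shiftA.
  by move=> /(shiftA _ h^-1%g); rewrite [irr_shift _ _](actK (shift_action C) h).
have := pgroup_fix_mod pG act.
rewrite (_ : 'Fix_(_ | _)(_)%g = finset.set0) ?cards0 ?mod0n => [/eqP //|].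
apply/eqP; rewrite -finset.subset0; apply/fintype.subsetP => j; rewrite inE => /andP[].
rewrite inE => /andP[/asboolP jg _] /afixP jfix; case/eqP: g_neq1.
apply: (fixed_degree1 C_univ oddG char_k jg) => h; exact: jfix.
Qed.
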